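(* Let $p$ be a prime and $S$ a finite $p$-group. Let $X\in A(S,S)_{(p)}$ be a bifree element whose augmentation $\epsilon(X)$ is not divisible by $p$. Then $X$ is a right characteristic element for some saturated fusion system on $S$ if and only if $X$ satisfies Frobenius reciprocity.
   Context: **Fusion systems.** Write $c_g(x)=gxg^{-1}$. A fusion system $\mathcal{F}$ on a finite $p$-group $S$ is a category whose objects are the subgroups of $S$ and whose morphism sets $\mathrm{Hom}_{\mathcal{F}}(P,Q)$ are sets of injective group homomorphisms $P\to Q$, with the usual composition, such that (1) every $c_x|_P:P\to Q$ with $x\in S$, $xPx^{-1}\le Q$, is in $\mathrm{Hom}_{\mathcal{F}}(P,Q)$; (2) for $\varphi\in\mathrm{Hom}_{\mathcal{F}}(P,Q)$ the induced isomorphism $P\to\varphi(P)$ and its inverse are morphisms in $\mathcal{F}$. Subgroups $P,Q$ are $\mathcal{F}$-conjugate if there is an isomorphism $P\to Q$ in $\mathcal{F}$. $P$ is fully $\mathcal{F}$-centralized (resp. fully $\mathcal{F}$-normalized) if $|C_S(P)|\ge|C_S(Q)|$ (resp. $|N_S(P)|\ge|N_S(Q)|$) for all $Q$ that are $\mathcal{F}$-conjugate to $P$. $\mathrm{Aut}_S(P)$ is the group of automorphisms of $P$ induced by conjugation by elements of $N_S(P)$. $\mathcal{F}$ is saturated if: (I) if $P\le S$ is fully $\mathcal{F}$-normalized, then $P$ is fully $\mathcal{F}$-centralized and $\mathrm{Aut}_S(P)$ is a Sylow $p$-subgroup of $\mathrm{Aut}_{\mathcal{F}}(P)$; (II) if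 $\varphi\in\mathrm{Hom}_{\mathcal{F}}(P,S)$ and $\varphi(P)$ is fully $\mathcal{F}$-centralized, then $\varphi$ extends to some $\overline\varphi\in\mathrm{Hom}_{\mathcal{F}}(N_\varphi,S)$, where $N_\varphi=\{x\in N_S(P)\mid \exists y\in N_S(\varphi(P)):\ \varphi(xux^{-1})=y\varphi(u)y^{-1}\ \forall u\in P\}$. **Burnside modules.** For finite groups $G,H$, a $(G,H)$-biset is a finite set with commuting right $G$-action and left $H$-action; it is left-free if $H$ acts freely, bifree if both $G$ and $H$ act freely. $A(G,H)$ is the Grothendieck group (under disjoint union) of isomorphism classes of finite left-free $(G,H)$-bisets. For $K\le G$ and a homomorphism $\varphi:K\to H$, $[K,\varphi]=[K,\varphi]_G^H\in A(G,H)$ is the class of $(H\times G)/\sim$ where $(x\varphi(k),y)\sim(x,ky)$ for $k\in K$. These classes form a $\mathbb{Z}$-basis, one for each $H\times G$-conjugacy class of graphs $\Delta(K,\varphi)=\{(\varphi(k),k)\mid k\in K\}$. Composition $A(H,L)\times A(G,H)\to A(G,L)$ is the bilinear map with $[X]\circ[Y]=[X\times_H Y]$. $A(G,H)_{(p)}=A(G,H)\otimes\mathbb{Z}_{(p)}$. An element of $A(S,S)_{(p)}$ is bifree if it lies in the $\mathbb{Z}_{(p)}$-span of classes of bifree bisets (equivalently of the $[P,\varphi]$ with $\varphi$ injective). The augmentation $\epsilon:A(S,S)_{(p)}\to\mathbb{Z}_{(p)}$ is the linear map with $\epsilon([X])=|S\backslash X|$, so $\epsilon([P,\varphi])=|S|/|P|$.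 ''incl'' denotes an inclusion map. **Right characteristic elements.** $\Omega\in A(S,S)_{(p)}$ is a right characteristic element for a fusion system $\mathcal{F}$ on $S$ if (a) it is $\mathcal{F}$-generated: it lies in the $\mathbb{Z}_{(p)}$-span of the $[P,\varphi]_S^S$ with $P\le S$, $\varphi\in\mathrm{Hom}_{\mathcal{F}}(P,S)$; (b) it is right $\mathcal{F}$-stable: $\Omega\circ[P,\varphi]_P^S=\Omega\circ[P,\mathrm{incl}]_P^S$ in $A(P,S)_{(p)}$ for all $P\le S$, $\varphi\in\mathrm{Hom}_{\mathcal{F}}(P,S)$; (c) $\epsilon(\Omega)$ is not divisible by $p$. **Frobenius reciprocity.** Cartesian product of bisets induces bilinear pairings $A(G_1,H_1)\times A(G_2,H_2)\to A(G_1\times G_2,H_1\times H_2)$, $(X,Y)\mapsto X\times Y$ (also $p$-locally). With $\Delta:S\to S\times S$ the diagonal, $[S,\Delta]\in A(S,S\times S)$ and $1=[S,\mathrm{id}]$, an element $X\in A(S,S)_{(p)}$ satisfies Frobenius reciprocity if $(X\times X)\circ[S,\Delta]=(X\times 1)\circ[S,\Delta]\circ X$ in $A(S,S\times S)_{(p)}$. *)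

(* Defs.v *)
From HB Require Import structures.
From mathcomp Require Import all_boot all_order all_algebra all_fingroup all_solvable.
From mathcomp Require Import boolp.
From mathcomp.multinomials Require Import freeg.

Set Implicit Arguments.
Unset Strict Implicit.
Unset Printing Implicit Defensive.

Import GRing.Theory generic_quotient.
Local Open Scope ring_scope.
Local Open Scope quotient_scope.

(* For a prime p, [coprime p d] says that p does not divide d.               *)
Definition plocal (p : nat) : {pred rat} := fun x => coprime p `|denq x|%N.

Lemma denq_dvd (a b : int) : b != 0 -> (denq (a%:Q / b%:Q) %| b)%Z.
Proof.
move=> b0; apply/dvdzP; case: (divqP a b) => [b00|k x k0]; first by rewrite b00 in b0.
by exists k; rewrite mulrC.
Qed.

Lemma plocal_frac p (a b : int) : b != 0 -> coprime p `|b|%N ->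
  a%:Q / b%:Q \in plocal p.
Proof.
move=> b0; rewrite unfold_in; apply: coprime_dvdr.
by have := denq_dvd a b0; rewrite dvdzE.
Qed.

Lemma plocal_subring p : subring_closed (plocal p).
Proof.
split=> [|x y|x y]; first by rewrite unfold_in coprimen1.
- rewrite !unfold_in => hx hy; rewrite -[x]divq_num_den -[y]divq_num_den.
  rewrite -mulNr addf_div ?intr_eq0 ?denq_eq0 // -rmorphN -!rmorphM -rmorphD.
  by apply: plocal_frac; rewrite ?mulf_neq0 ?denq_eq0 // abszM coprimeMr hx.
- rewrite !unfold_in => hx hy; rewrite -[x]divq_num_den -[y]divq_num_den.
  rewrite mulf_div -!rmorphM.
  by apply: plocal_frac; rewrite ?mulf_neq0 ?denq_eq0 // abszM coprimeMr hx.
Qed.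

HB.instance Definition _ p :=
  GRing.isSubringClosed.Build rat (plocal p) (plocal_subring p).

Record zloc (p : nat) := Zloc { zloc_val :> rat; _ : zloc_val \in plocal p }.

HB.instance Definition _ p := [isSub for @zloc_val p].
HB.instance Definition _ p := [Choice of zloc p by <:].
HB.instance Definition _ p := [SubChoice_isSubComNzRing of zloc p by <:].

Definition zloc_pdvd p (x : zloc p) : Prop := exists y : zloc p, x = p%:R * y.

Section Bisets.
Variables (gT hT : finGroupType) (G : {group gT}) (H : {group hT}).

(* Left-free (G, H)-biset structures on T: H acts on the left by l, G acts   *)
(* on the right by r. Only the values of l on H and of r on G are meaningful. *)
Record biset_axioms (T : finType) (l : hT -> T -> T) (r : T -> gT -> T) : Prop
    := BisetAxioms {
  bax_l1 : forall x, l 1%g x = x;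
  bax_lM : {in H &, forall h k x, l (h * k)%g x = l h (l k x)};
  bax_r1 : forall x, r x 1%g = x;
  bax_rM : {in G &, forall g k x, r x (g * k)%g = r (r x g) k};
  bax_lr : {in H & G, forall h g x, r (l h x) g = l h (r x g)};
  bax_free : {in H, forall h x, l h x = x -> h = 1%g} }.

Record biset_on (T : finType) : Type := BisetOn {
  lact : hT -> T -> T;
  ract : T -> gT -> T;
  biset_onP : biset_axioms lact ract }.

Record biset : Type :=
  Biset { bcarrier :> finType; bstruct :> biset_on bcarrier }.

Definition bifree (X : biset) : Prop :=
  {in G, forall g (x : X), ract X x g = x -> g = 1%g}.

Definition biset_iso (X Y : biset) : Prop :=
  exists f : X -> Y,
  [/\ bijective f, {in H, forall h x, f (lact X h x) = lact Y h (f x)}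
    & {in G, forall g x, f (ract X x g) = ract Y (f x) g}].

Section Theory.
Variable X : biset.
Lemma lact1 x : lact X 1%g x = x. Proof. exact: bax_l1 (biset_onP X) x. Qed.
Lemma lactM : {in H &, forall h k x, lact X (h * k)%g x = lact X h (lact X k x)}.
Proof. exact: bax_lM (biset_onP X). Qed.
Lemma ract1 x : ract X x 1%g = x. Proof. exact: bax_r1 (biset_onP X) x. Qed.
Lemma ractM : {in G &, forall g k x, ract X x (g * k)%g = ract X (ract X x g) k}.
Proof. exact: bax_rM (biset_onP X). Qed.
Lemma lractA :
  {in H & G, forall h g x, ract X (lact X h x) g = lact X h (ract X x g)}.
Proof. exact: bax_lr (biset_onP X). Qed.
Lemma lact_free : {in H, forall h x, lact X h x = x -> h = 1%g}.
Proof. exact: bax_free (biset_onP X). Qed.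
Lemma lactK h x : h \in H -> lact X h^-1%g (lact X h x) = x.
Proof. by move=> hH; rewrite -lactM ?groupV // mulVg lact1. Qed.
Lemma lactKV h x : h \in H -> lact X h (lact X h^-1%g x) = x.
Proof. by move=> hH; rewrite -lactM ?groupV // mulgV lact1. Qed.
Lemma ractK g x : g \in G -> ract X (ract X x g) g^-1%g = x.
Proof. by move=> gG; rewrite -ractM ?groupV // mulgV ract1. Qed.
Lemma ractKV g x : g \in G -> ract X (ract X x g^-1%g) g = x.
Proof. by move=> gG; rewrite -ractM ?groupV // mulVg ract1. Qed.
End Theory.

Lemma biset_iso_refl X : biset_iso X X.
Proof. by exists id; split=> //; exists id. Qed.

Lemma biset_iso_sym X Y : biset_iso X Y -> biset_iso Y X.
Proof.
case=> f [[g fK gK] fl fr]; exists g; split; first by exists f.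
- by move=> h hH y; apply: (can_inj fK); rewrite gK fl // gK.
- by move=> h hH y; apply: (can_inj fK); rewrite gK fr // gK.
Qed.

Lemma biset_iso_trans X Y Z : biset_iso X Y -> biset_iso Y Z -> biset_iso X Z.
Proof.
case=> f [fb fl fr] [g [gb gl gr]]; exists (g \o f); split.
- exact: bij_comp.
- by move=> h hH x /=; rewrite fl // gl.
- by move=> h hH x /=; rewrite fr // gr.
Qed.

Section Sum.
Variables X Y : biset.

Definition sum_lact (h : hT) (u : X + Y) : X + Y :=
  match u with inl x => inl (lact X h x) | inr y => inr (lact Y h y) end.
Definition sum_ract (u : X + Y) (g : gT) : X + Y :=
  match u with inl x => inl (ract X x g) | inr y => inr (ract Y y g) end.

Fact bsum_subproof : biset_axioms sum_lact sum_ract.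
Proof.
split.
- by case=> x /=; rewrite lact1.
- by move=> h k hH kH [] x /=; rewrite lactM.
- by case=> x /=; rewrite ract1.
- by move=> h k hH kH [] x /=; rewrite ractM.
- by move=> h k hH kH [] x /=; rewrite lractA.
- by move=> h hH [] x /= [] /lact_free->.
Qed.

Definition bsum : biset := Biset (BisetOn bsum_subproof).
End Sum.

Lemma bsum_iso X X' Y Y' :
  biset_iso X X' -> biset_iso Y Y' -> biset_iso (bsum X Y) (bsum X' Y').
Proof.
case=> f [[f' fK f'K] fl fr] [g [[g' gK g'K] gl gr]].
exists (fun u : bsum X Y =>
  match u with inl x => inl (f x) | inr y => inr (g y) end : bsum X' Y'); split.
- exists (fun u : bsum X' Y' =>
    match u with inl x => inl (f' x) | inr y => inr (g' y) end : bsum X Y).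
    by case=> x; rewrite ?fK ?gK.
  by case=> x; rewrite ?f'K ?g'K.
- by move=> h hH [] x /=; rewrite ?fl ?gl.
- by move=> h hG [] x /=; rewrite ?fr ?gr.
Qed.

Fact bempty_subproof :
  biset_axioms (T := void) (fun _ x => x) (fun x _ => x).
Proof. by split=> // h hH []. Qed.
Definition bempty : biset := Biset (BisetOn bempty_subproof).

Lemma bsum_empty X : biset_iso X (bsum X bempty).
Proof.
exists (fun x => inl x : bsum X bempty); split=> //.
by exists (fun u : bsum X bempty => if u is inl x then x else
  match u with inl x => x | inr v => match v with end end) => // -[].
Qed.

Section Quotient.
Variables (X : biset) (e : equiv_rel X).
Hypotheses
  (el : {in H, forall h x y, e x y -> e (lact X h x) (lact X h y)})
  (er : {in G, forall g x y, e x y -> e (ract X x g) (ract X y g)})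
  (ef : {in H, forall h x, e (lact X h x) x -> h = 1%g}).

Definition quo_carrier : finType := quot_type {eq_quot e}.
Definition quo_pi (x : X) : quo_carrier := \pi_{eq_quot e} x.
Definition quo_repr (u : quo_carrier) : X := repr (u : {eq_quot e}).

Lemma quo_ind (P : quo_carrier -> Prop) :
  (forall x, P (quo_pi x)) -> forall u, P u.
Proof. by move=> Ppi u; rewrite -[u]reprK; apply: Ppi. Qed.

Lemma quo_piP x y : reflect (quo_pi x = quo_pi y) (e x y).
Proof. exact: (@eqmodP _ e x y). Qed.

Lemma quo_reprK u : quo_pi (quo_repr u) = u.
Proof. exact: reprK. Qed.

Definition quo_lact (h : hT) (u : quo_carrier) : quo_carrier :=
  quo_pi (lact X h (quo_repr u)).
Definition quo_ract (u : quo_carrier) (g : gT) : quo_carrier :=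
  quo_pi (ract X (quo_repr u) g).

Lemma quo_lactE h x : h \in H -> quo_lact h (quo_pi x) = quo_pi (lact X h x).
Proof. by move=> hH; apply/quo_piP/el => //; apply/quo_piP/quo_reprK. Qed.

Lemma quo_ractE g x : g \in G -> quo_ract (quo_pi x) g = quo_pi (ract X x g).
Proof. by move=> gG; apply/quo_piP/er => //; apply/quo_piP/quo_reprK. Qed.

Fact bquo_subproof : biset_axioms quo_lact quo_ract.
Proof.
split.
- by elim/quo_ind=> x; rewrite quo_lactE ?lact1.
- by move=> h k hH kH; elim/quo_ind=> x; rewrite !quo_lactE ?groupM // lactM.
- by elim/quo_ind=> x; rewrite quo_ractE ?ract1.
- by move=> h k hH kH; elim/quo_ind=> x; rewrite !quo_ractE ?groupM // ractM.
- move=> h k hH kH; elim/quo_ind=> x.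
  by rewrite quo_lactE // !quo_ractE // quo_lactE // lractA.
- by move=> h hH; elim/quo_ind=> x; rewrite quo_lactE // => /quo_piP/ef->.
Qed.

Definition bquo : biset := Biset (BisetOn bquo_subproof).

Lemma bquo_iso (Z : biset) (f : X -> Z) :
    (forall x y, e x y <-> f x = f y) -> (forall z, exists x, f x = z) ->
    {in H, forall h x, f (lact X h x) = lact Z h (f x)} ->
    {in G, forall g x, f (ract X x g) = ract Z (f x) g} ->
  biset_iso bquo Z.
Proof.
move=> fe fs fl fr.
have frepr x : f (quo_repr (quo_pi x)) = f x.
  by apply/fe/quo_piP; rewrite quo_reprK.
exists (fun u : bquo => f (quo_repr u)); split.
- have /fin_all_exists[g fg] : forall z, exists x, f x = z by exact: fs.
  exists (fun z => quo_pi (g z) : bquo) => [u|z]; last by rewrite frepr fg.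
  rewrite -[RHS]quo_reprK; apply/quo_piP/fe; exact: fg.
- by move=> h hH u /=; rewrite frepr fl.
- by move=> h hH u /=; rewrite frepr fr.
Qed.
End Quotient.

Section Ord.
Variable X : biset.

Definition ord_lact h (i : 'I_#|X|) := enum_rank (lact X h (enum_val i)).
Definition ord_ract (i : 'I_#|X|) g := enum_rank (ract X (enum_val i) g).

Fact bord_subproof : biset_axioms ord_lact ord_ract.
Proof.
rewrite /ord_lact /ord_ract; split.
- by move=> i; rewrite lact1 enum_valK.
- by move=> h k hH kH i; rewrite enum_rankK lactM.
- by move=> i; rewrite ract1 enum_valK.
- by move=> h k hH kH i; rewrite enum_rankK ractM.
- by move=> h k hH kH i; rewrite !enum_rankK lractA.
- move=> h hH i /(congr1 enum_val); rewrite enum_rankK; exact: lact_free.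
Qed.
End Ord.

(* The bisets carried by some {0, ..., n - 1}: every biset is isomorphic to  *)
(* one of these, and unlike those of biset they form a small type.           *)
Record obiset : Type := OBiset { osize : nat; ostruct : biset_on 'I_osize }.

Definition obiset_biset (X : obiset) : biset := Biset (ostruct X).
Coercion obiset_biset : obiset >-> biset.

HB.instance Definition _ := gen_eqMixin obiset.
HB.instance Definition _ := gen_choiceMixin obiset.

Definition bord (X : biset) : obiset := OBiset (BisetOn (bord_subproof X)).

Lemma bordP (X : biset) : biset_iso (bord X) X.
Proof.
exists enum_val; split=> [|h _ x|h _ x] /=; last 2 first.
- exact: enum_rankK.
- exact: enum_rankK.
exists enum_rank; [exact: enum_valK | exact: enum_rankK].
Qed.

End Bisets.

Section Composition.
Variables (gT hT kT : finGroupType).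
Variables (G : {group gT}) (H : {group hT}) (L : {group kT}).
Variables (X : biset H L) (Y : biset G H).

Definition pair_lact (l : kT) (u : X * Y) : X * Y := (lact X l u.1, u.2).
Definition pair_ract (u : X * Y) (g : gT) : X * Y := (u.1, ract Y u.2 g).

Fact pair_subproof : biset_axioms G L pair_lact pair_ract.
Proof.
rewrite /pair_lact /pair_ract; split=> //=.
- by case=> x y /=; rewrite lact1.
- by move=> h k hL kL [x y] /=; rewrite lactM.
- by case=> x y /=; rewrite ract1.
- by move=> g k gG kG [x y] /=; rewrite ractM.
- by move=> h hL [x y] /= [] /lact_free->.
Qed.

Definition bpair : biset G L := Biset (BisetOn pair_subproof).

(* u = (x h, y) and v = (x, h y) for some h in H *)
Definition comp_rel (u v : X * Y) : bool :=
  [exists h in H, (u.1 == ract X v.1 h) && (v.2 == lact Y h u.2)].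

Fact comp_equiv_subproof : equiv_class_of comp_rel.
Proof.
split=> [[x y]|[x y] [x' y']|[x1 y1] [x2 y2] [x3 y3]].
- by apply/exists_inP; exists 1%g; rewrite //= ract1 lact1 !eqxx.
- apply/idP/idP => /exists_inP[h hH /=] /andP[/eqP-> /eqP->];
  by apply/exists_inP; exists h^-1%g; rewrite ?groupV //= ractK ?lactK ?eqxx.
- case/exists_inP=> h hH /= /andP[/eqP-> /eqP->].
  case/exists_inP=> k kH /= /andP[/eqP-> /eqP->].
  by apply/exists_inP; exists (k * h)%g; rewrite ?groupM //= ractM ?lactM ?eqxx.
Qed.

Definition comp_equiv : equiv_rel bpair := EquivRelPack comp_equiv_subproof.

Fact comp_l_subproof : {in L, forall l u v,
  comp_equiv u v -> comp_equiv (lact bpair l u) (lact bpair l v)}.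
Proof.
move=> l lL [x y] [x' y'] /exists_inP[h hH /= /andP[/eqP-> /eqP->]].
by apply/exists_inP; exists h; rewrite //= lractA ?eqxx.
Qed.

Fact comp_r_subproof : {in G, forall g u v,
  comp_equiv u v -> comp_equiv (ract bpair u g) (ract bpair v g)}.
Proof.
move=> g gG [x y] [x' y'] /exists_inP[h hH /= /andP[/eqP-> /eqP->]].
by apply/exists_inP; exists h; rewrite //= lractA ?eqxx.
Qed.

Fact comp_free_subproof : {in L, forall l u,
  comp_equiv (lact bpair l u) u -> l = 1%g}.
Proof.
move=> l lL [x y] /exists_inP[h hH /= /andP[/eqP lx /eqP hy]].
have h1 : h = 1%g by apply: (lact_free (X := Y)) (esym hy).
by move: lx; rewrite h1 ract1 => /lact_free->.
Qed.

Definition btimes : biset G L :=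
  bquo comp_l_subproof comp_r_subproof comp_free_subproof.
End Composition.

Section Product.
Variables (gT1 hT1 gT2 hT2 : finGroupType).
Variables (G1 : {group gT1}) (H1 : {group hT1}).
Variables (G2 : {group gT2}) (H2 : {group hT2}).
Variables (X1 : biset G1 H1) (X2 : biset G2 H2).

Definition prod_lact (h : hT1 * hT2) (u : X1 * X2) : X1 * X2 :=
  (lact X1 h.1 u.1, lact X2 h.2 u.2).
Definition prod_ract (u : X1 * X2) (g : gT1 * gT2) : X1 * X2 :=
  (ract X1 u.1 g.1, ract X2 u.2 g.2).

Fact prod_subproof :
  biset_axioms (setX_group G1 G2) (setX_group H1 H2) prod_lact prod_ract.
Proof.
rewrite /prod_lact /prod_ract; split.
- by case=> x y /=; rewrite !lact1.
- move=> [h h'] [k k'] /setXP[/= ? ?] /setXP[/= ? ?] [x y] /=.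
  by rewrite !lactM.
- by case=> x y /=; rewrite !ract1.
- move=> [h h'] [k k'] /setXP[/= ? ?] /setXP[/= ? ?] [x y] /=.
  by rewrite !ractM.
- move=> [h h'] [k k'] /setXP[/= ? ?] /setXP[/= ? ?] [x y] /=.
  by rewrite !lractA.
- by move=> [h h'] /setXP[/= ? ?] [x y] /= [] /lact_free-> // /lact_free->.
Qed.

Definition bprod : biset (setX_group G1 G2) (setX_group H1 H2) :=
  Biset (BisetOn prod_subproof).
End Product.

Section Transitive.
Variables (gT hT : finGroupType) (G : {group gT}) (H : {group hT}).

Definition reg_lact (h : hT) (u : [subg H] * [subg G]) : [subg H] * [subg G] :=
  ((subg H h * u.1)%g, u.2).
Definition reg_ract (u : [subg H] * [subg G]) (g : gT) : [subg H] * [subg G] :=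
  (u.1, (u.2 * subg G g)%g).

Fact reg_subproof : biset_axioms G H reg_lact reg_ract.
Proof.
rewrite /reg_lact /reg_ract; split=> //=.
- by case=> x y /=; rewrite (morph1 (subg_morphism H)) mul1g.
- by move=> h k hH kH [x y] /=; rewrite subgM // mulgA.
- by case=> x y /=; rewrite (morph1 (subg_morphism G)) mulg1.
- by move=> h k hH kH [x y] /=; rewrite subgM // mulgA.
move=> h hH [x y] /= [] /(canRL (mulgK _)); rewrite mulgV => /(congr1 val) /=.
by rewrite subgK.
Qed.

Definition breg : biset G H := Biset (BisetOn reg_subproof).

Variables (K : {group gT}) (phi : {morphism K >-> hT}).

(* u = (x phi(k), y) and v = (x, k y) for some k in K *)
Definition trans_rel (u v : [subg H] * [subg G]) : bool :=
  [exists k in K, (val u.1 == val v.1 * phi k)%g && (val v.2 == k * val u.2)%g].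

Fact trans_equiv_subproof : equiv_class_of trans_rel.
Proof.
split=> [[x y]|[x y] [x' y']|[x1 y1] [x2 y2] [x3 y3]].
- by apply/exists_inP; exists 1%g; rewrite //= morph1 mulg1 mul1g !eqxx.
- apply/idP/idP => /exists_inP[k kK /= /andP[/eqP ex /eqP ey]];
  by apply/exists_inP; exists k^-1%g;
    rewrite ?groupV //= morphV // ex ey mulgK mulKg !eqxx.
- case/exists_inP=> h hK /= /andP[/eqP ex1 /eqP ey2].
  case/exists_inP=> k kK /= /andP[/eqP ex2 /eqP ey3].
  apply/exists_inP; exists (k * h)%g; rewrite ?groupM //=.
  by rewrite morphM // ex1 ex2 ey3 ey2 !mulgA !eqxx.
Qed.

Definition trans_equiv : equiv_rel breg := EquivRelPack trans_equiv_subproof.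

Fact trans_l_subproof : {in H, forall l u v,
  trans_equiv u v -> trans_equiv (lact breg l u) (lact breg l v)}.
Proof.
move=> l lL [x y] [x' y'] /exists_inP[k kK /= /andP[/eqP ex /eqP ey]].
by apply/exists_inP; exists k; rewrite //= ex ey mulgA !eqxx.
Qed.

Fact trans_r_subproof : {in G, forall g u v,
  trans_equiv u v -> trans_equiv (ract breg u g) (ract breg v g)}.
Proof.
move=> g gG [x y] [x' y'] /exists_inP[k kK /= /andP[/eqP ex /eqP ey]].
by apply/exists_inP; exists k; rewrite //= ex ey mulgA !eqxx.
Qed.

Fact trans_free_subproof : {in H, forall l u,
  trans_equiv (lact breg l u) u -> l = 1%g}.
Proof.
move=> l lH [x y] /exists_inP[k kK /= /andP[/eqP lx /eqP ky]].
have k1 : k = 1%g by apply: (mulIg (sgval y)); rewrite -ky mul1g.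
move: lx; rewrite k1 morph1 mulg1 subgK // => lx.
by apply: (mulIg (sgval x)); rewrite lx mul1g.
Qed.

Definition btrans : biset G H :=
  bquo trans_l_subproof trans_r_subproof trans_free_subproof.
End Transitive.
Arguments btrans {gT hT} G H {K} phi.

Definition in_span (R : pzRingType) (V : lmodType R) (B : V -> Prop) (v : V) :
    Prop :=
  exists2 s : seq (R * V),
    {in s, forall cb, B cb.2} & v = \sum_(cb <- s) cb.1 *: cb.2.

Section Span.
Variables (R : pzRingType) (V : lmodType R) (B : V -> Prop).

Lemma in_span_gen v : B v -> in_span B v.
Proof.
move=> Bv; exists [:: (1, v)]; last by rewrite big_seq1 scale1r.
by move=> cb; rewrite inE => /eqP->.
Qed.

Lemma in_span0 : in_span B 0.
Proof. by exists [::] => //; rewrite big_nil. Qed.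

Lemma in_spanD u v : in_span B u -> in_span B v -> in_span B (u + v).
Proof.
case=> s Bs -> [t Bt ->]; exists (s ++ t); last by rewrite big_cat.
by move=> cb; rewrite mem_cat => /orP[/Bs | /Bt].
Qed.

Lemma in_spanZ a v : in_span B v -> in_span B (a *: v).
Proof.
case=> s Bs ->; exists [seq (a * cb.1, cb.2) | cb <- s].
  by move=> cb /mapP[x /Bs Bx ->].
by rewrite big_map scaler_sumr; apply: eq_bigr => i _; rewrite scalerA.
Qed.

Lemma in_spanB u v : in_span B u -> in_span B v -> in_span B (u - v).
Proof. by move=> Bu Bv; rewrite -scaleN1r; apply/in_spanD/in_spanZ. Qed.
End Span.

Section Burnside.
Variables (p : nat) (gT hT : finGroupType) (G : {group gT}) (H : {group hT}).
Local Notation F := {freeg (obiset G H) / (zloc p)}.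

(* The relations [Z] = [X] + [Y] for Z isomorphic to the disjoint union of X *)
(* and Y; taking Y empty, they entail that isomorphic bisets have equal      *)
(* classes.                                                                  *)
Definition brelator (D : F) : Prop :=
  exists2 XYZ : obiset G H * obiset G H * obiset G H,
    biset_iso XYZ.2 (bsum XYZ.1.1 XYZ.1.2) &
    D = << XYZ.2 >> - << XYZ.1.1 >> - << XYZ.1.2 >>.

Definition brel : {pred F} := fun D => `[< in_span brelator D >].

Fact brel_zmod_closed : zmod_closed brel.
Proof.
split=> [|x y]; rewrite !unfold_in; first exact/asboolP/in_span0.
by move=> /asboolP rx /asboolP ry; apply/asboolP/in_spanB.
Qed.

HB.instance Definition _ := GRing.isZmodClosed.Build F brel brel_zmod_closed.

(* A(G, H)_(p): since - \otimes Z_(p) is right exact, it is the quotient of  *)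
(* the free Z_(p)-module on bisets by the relations defining the             *)
(* Grothendieck group.                                                       *)
Definition burnside : Type := Quotient.quot brel.

HB.instance Definition _ := GRing.Zmodule.on burnside.

Definition bpi (D : F) : burnside := \pi_(Quotient.quot brel) D.
Definition brepr (a : burnside) : F := repr (a : (Quotient.quot brel)).

Lemma breprK a : bpi (brepr a) = a. Proof. exact: reprK. Qed.

Lemma bpi_eqP D E : bpi D = bpi E <-> in_span brelator (D - E).
Proof.
have -> : in_span brelator (D - E) <-> D - E \in brel.
  by rewrite unfold_in; split=> /asboolP.
have -> : (D - E \in brel) = (D == E %[mod (Quotient.quot brel)]).
  exact: Quotient.idealrBE.
by split=> /eqP.
Qed.

Lemma bpiD D E : bpi (D + E) = bpi D + bpi E. Proof. exact: raddfD. Qed.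
Lemma bpiB D E : bpi (D - E) = bpi D - bpi E. Proof. exact: raddfB. Qed.

Definition bscale (c : zloc p) (a : burnside) : burnside := bpi (c *: brepr a).

Lemma bscale_pi c D : bpi (c *: D) = bscale c (bpi D).
Proof.
apply/bpi_eqP; rewrite -scalerBr; apply/in_spanZ/bpi_eqP.
by rewrite breprK.
Qed.

Fact bscaleA c d a : bscale c (bscale d a) = bscale (c * d) a.
Proof. by rewrite -[a]breprK -!bscale_pi scalerA. Qed.
Fact bscale1 : left_id 1 bscale.
Proof. by move=> a; rewrite -[a]breprK -!bscale_pi scale1r. Qed.
Fact bscaleDr : right_distributive bscale +%R.
Proof.
by move=> c a b; rewrite -[a]breprK -[b]breprK -bpiD -!bscale_pi -bpiD scalerDr.
Qed.
Fact bscaleDl a : {morph bscale^~ a : c d / c + d}.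
Proof. by move=> c d; rewrite -[a]breprK -!bscale_pi -bpiD scalerDl. Qed.

HB.instance Definition _ := GRing.Zmodule_isLmodule.Build (zloc p) burnside
  bscaleA bscale1 bscaleDr bscaleDl.

Lemma bpiZ c D : bpi (c *: D) = c *: bpi D. Proof. exact: bscale_pi. Qed.

Definition bcls (X : biset G H) : burnside := bpi << bord X >>.

Lemma bcls_sum (Z X Y : biset G H) :
  biset_iso Z (bsum X Y) -> bcls Z = bcls X + bcls Y.
Proof.
move=> ZXY; apply: subr0_eq; rewrite opprD addrA -!bpiB.
have <- : bpi 0 = 0 by rewrite -(subrr 0) bpiB subrr.
apply/bpi_eqP/in_span_gen; exists (bord X, bord Y, bord Z); last by rewrite subr0.
apply: biset_iso_trans (bordP Z) _; apply: biset_iso_trans ZXY _.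
by apply: bsum_iso; apply/biset_iso_sym/bordP.
Qed.

Section Lift.
Variable V : lmodType (zloc p).

Definition badditive (f : biset G H -> V) : Prop :=
  forall Z X Y, biset_iso Z (bsum X Y) -> f Z = f X + f Y.

Definition blift (f : biset G H -> V) (a : burnside) : V :=
  fglift (fun X : obiset G H => f X) (brepr a).

Section Fglift.
Variable f : obiset G H -> V.
Local Notation ff := (fglift f : F -> V).

Lemma fglift_sum D : ff D = \sum_(X <- dom D) coeff X D *: f X.
Proof. by rewrite -{1}[D]Freeg_dom fglift_Freeg /prelift big_map. Qed.
Lemma fgliftB D E : ff (D - E) = ff D - ff E.
Proof. exact: lift_is_additive. Qed.
Lemma fglift0 : ff 0 = 0.
Proof. by rewrite -(subrr 0) fgliftB subrr. Qed.
Lemma fgliftD D E : ff (D + E) = ff D + ff E.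
Proof. by rewrite -[E in LHS]opprK fgliftB -[- E]add0r fgliftB fglift0 sub0r opprK. Qed.
Lemma fgliftZ c D : ff (c *: D) = c *: ff D.
Proof.
rewrite -[D]freeg_sumE scaler_sumr; elim: (dom D) => [|X s IHs].
  by rewrite !big_nil fglift0 scaler0.
rewrite !big_cons !fgliftD IHs scalerDr; congr (_ + _).
have -> : c *: << coeff X D *g X >> = << c * coeff X D *g X >> :> F.
  by apply/eqP/freeg_eqP=> Y; rewrite coeffZ !coeffU mulrA.
by rewrite !liftU scalerA.
Qed.
End Fglift.

Lemma blift_sum (f : biset G H -> V) a :
  blift f a = \sum_(X <- dom (brepr a)) coeff X (brepr a) *: f X.
Proof. exact: fglift_sum. Qed.

Variable f : biset G H -> V.
Hypothesis fD : badditive f.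

Lemma badditive_empty : f (bempty G H) = 0.
Proof.
have /eqP := fD (bsum_empty (bempty G H)).
by rewrite -subr_eq0 opprD addNKr oppr_eq0 => /eqP.
Qed.

Lemma badditive_iso X Y : biset_iso X Y -> f X = f Y.
Proof.
move=> XY; rewrite (fD (biset_iso_trans XY (bsum_empty Y))).
by rewrite badditive_empty addr0.
Qed.

Lemma blift_bpi D : blift f (bpi D) = fglift (fun X : obiset G H => f X) D.
Proof.
apply: subr0_eq; rewrite /blift -fgliftB.
have /bpi_eqP : bpi (brepr (bpi D)) = bpi D by rewrite breprK.
case=> s Bs ->; elim: s Bs => [|[c E] s IHs] Bs; first by rewrite big_nil fglift0.
rewrite big_cons fgliftD fgliftZ IHs ?addr0; last first.
  by move=> i si; apply: Bs; rewrite inE si orbT.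
have [[[X Y] Z] /= /fD XYZ ->] := Bs _ (mem_head _ _).
by rewrite !fgliftB !liftU !scale1r XYZ addrAC addrK subrr scaler0.
Qed.

Lemma blift_bcls X : blift f (bcls X) = f X.
Proof. by rewrite blift_bpi liftU scale1r; apply/badditive_iso/bordP. Qed.

Lemma blift_linear : linear (blift f).
Proof.
move=> c a b; rewrite -[a]breprK -[b]breprK -bpiZ -bpiD !blift_bpi.
by rewrite fgliftD fgliftZ.
Qed.
End Lift.

Section Lift2.
Variables (gT' hT' : finGroupType) (G' : {group gT'}) (H' : {group hT'}).
Variables (V : lmodType (zloc p)) (f : biset G' H' -> biset G H -> V).
Hypothesis fDl : forall Z X X' Y,
  biset_iso Z (bsum X X') -> f Z Y = f X Y + f X' Y.

Lemma badditive_lift2 b Z X X' : biset_iso Z (bsum X X') ->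
  blift (f Z) b = blift (f X) b + blift (f X') b.
Proof.
move=> ZXX'; rewrite !blift_sum -big_split /=; apply: eq_bigr => Y _.
by rewrite -scalerDr (fDl _ ZXX').
Qed.
End Lift2.

Lemma bcls_iso X Y : biset_iso X Y -> bcls X = bcls Y.
Proof. exact: (badditive_iso bcls_sum). Qed.

Lemma bpi_gen (X : obiset G H) : bpi << X >> = bcls X.
Proof.
rewrite -[RHS]addr0 -(badditive_empty bcls_sum).
apply: subr0_eq; rewrite opprD addrA -!bpiB.
have <- : bpi 0 = 0 by rewrite -(subrr 0) bpiB subrr.
apply/bpi_eqP/in_span_gen.
exists (bord X, bord (bempty G H), X); last by rewrite subr0.
apply: biset_iso_trans (bsum_empty X) _.
by apply: bsum_iso; apply/biset_iso_sym/bordP.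
Qed.
End Burnside.

Section TimesTheory.
Variables (gT hT kT : finGroupType).
Variables (G : {group gT}) (H : {group hT}) (L : {group kT}).
Implicit Types (X : biset H L) (Y : biset G H).

Section Pi.
Variables (X : biset H L) (Y : biset G H).

Definition tpi (u : X * Y) : btimes X Y := quo_pi (comp_equiv X Y) u.

Lemma tpiP u v : tpi u = tpi v <->
  exists2 h, h \in H & u.1 = ract X v.1 h /\ v.2 = lact Y h u.2.
Proof.
split=> [/(quo_piP (comp_equiv X Y))/exists_inP[h hH]|].
  by case/andP=> /eqP ? /eqP ?; exists h.
case=> h hH [ex ey]; apply/(quo_piP (comp_equiv X Y))/exists_inP.
by exists h; rewrite // ex ey !eqxx.
Qed.

Lemma tpi_ind (P : btimes X Y -> Prop) :
  (forall x y, P (tpi (x, y))) -> forall u, P u.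
Proof. by move=> Ppi; elim/quo_ind=> -[]. Qed.

Lemma tpi_l l x y : l \in L ->
  lact (btimes X Y) l (tpi (x, y)) = tpi (lact X l x, y).
Proof. move=> lL; apply: quo_lactE => //; exact: comp_l_subproof. Qed.

Lemma tpi_r g x y : g \in G ->
  ract (btimes X Y) (tpi (x, y)) g = tpi (x, ract Y y g).
Proof. move=> gG; apply: quo_ractE => //; exact: comp_r_subproof. Qed.

Lemma btimes_isoP (Z : biset G L) (f : X -> Y -> Z) :
    (forall x y x' y', f x y = f x' y' <->
       exists2 h, h \in H & x = ract X x' h /\ y' = lact Y h y) ->
    (forall z, exists x y, f x y = z) ->
    {in L, forall l x y, f (lact X l x) y = lact Z l (f x y)} ->
    {in G, forall g x y, f x (ract Y y g) = ract Z (f x y) g} ->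
  biset_iso (btimes X Y) Z.
Proof.
move=> fe fs fl fr; apply: (@bquo_iso _ _ _ _ _ _ (@comp_l_subproof _ _ _ _ _ _ X Y)
  (@comp_r_subproof _ _ _ _ _ _ X Y) (@comp_free_subproof _ _ _ _ _ _ X Y)
  Z (fun u => f u.1 u.2)) => [[x y] [x' y']|z|l lL [x y]|g gG [x y]] /=.
- split=> [/exists_inP[h hH /andP[/eqP ex /eqP ey]]|/fe[h hH [/= ex ey]]].
    by apply/fe; exists h.
  by apply/exists_inP; exists h; rewrite //= ex ey !eqxx.
- by have [x [y <-]] := fs z; exists (x, y).
- exact: fl.
- exact: fr.
Qed.
End Pi.

Lemma btimes_iso X X' Y Y' : biset_iso X X' -> biset_iso Y Y' ->
  biset_iso (btimes X Y) (btimes X' Y').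
Proof.
case=> f [[f' fK f'K] fl fr] [g [[g' gK g'K] gl gr]].
apply: (btimes_isoP (f := fun x y => tpi (f x, g y))) => [x y x' y'|||].
- split=> [/tpiP[h hH /= []]|[h hH [-> ->]]].
    by rewrite -fr // -gl // => /(can_inj fK)-> /(can_inj gK)->; exists h.
  by apply/tpiP; exists h; rewrite //= fr ?gl.
- by elim/tpi_ind=> x y; exists (f' x), (g' y); rewrite f'K g'K.
- by move=> h hL x y; rewrite tpi_l ?fl.
- by move=> h hL x y; rewrite tpi_r ?gr.
Qed.

Lemma btimes_suml X X' Y :
  biset_iso (btimes (bsum X X') Y) (bsum (btimes X Y) (btimes X' Y)).
Proof.
apply: (btimes_isoP (f := fun (x : bsum X X') y => match x with
  | inl x => inl (tpi (x, y)) | inr x => inr (tpi (x, y)) end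
  : bsum (btimes X Y) (btimes X' Y))).
- move=> x y x' y'; split=> [|[h hH []]].
    by case: x x' => x [] x' //= [] /tpiP[h hH [/= -> ->]]; exists h.
  case: x x' => x [] x' //= [->] ->; congr (_ _);
  by apply/tpiP; exists h.
- case; elim/tpi_ind=> x y; first by exists (inl x), y.
  by exists (inr x), y.
- by move=> h hL [] x y /=; rewrite -tpi_l.
- by move=> h hL [] x y /=; rewrite -tpi_r.
Qed.

Lemma btimes_sumr X Y Y' :
  biset_iso (btimes X (bsum Y Y')) (bsum (btimes X Y) (btimes X Y')).
Proof.
apply: (btimes_isoP (f := fun x (y : bsum Y Y') => match y with
  | inl y => inl (tpi (x, y)) | inr y => inr (tpi (x, y)) end
  : bsum (btimes X Y) (btimes X Y'))).
- move=> x y x' y'; split=> [|[h hH []]].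
    by case: y y' => y [] y' //= [] /tpiP[h hH [/= -> ->]]; exists h.
  case: y y' => y [] y' //= -> [->]; congr (_ _);
  by apply/tpiP; exists h.
- case; elim/tpi_ind=> x y; first by exists x, (inl y).
  by exists x, (inr y).
- by move=> h hL x [] y /=; rewrite -tpi_l.
- by move=> h hL x [] y /=; rewrite -tpi_r.
Qed.
End TimesTheory.

Section Identity.
Variables (gT hT : finGroupType) (G : {group gT}) (H : {group hT}).
Local Notation one := (btrans G G (idm_morphism G)).

Definition one_mul (y : one) : gT :=
  (val (quo_repr y).1 * val (quo_repr y).2)%g.

Lemma one_mulE u v :
  one_mul (quo_pi (trans_equiv G G (idm_morphism G)) (u, v)) =
  (val u * val v)%g.
Proof.
set e := trans_equiv _ _ _; rewrite /one_mul.
have /(quo_piP e)/exists_inP[k kG] := quo_reprK (quo_pi e (u, v)).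
by case/andP=> /= /eqP-> /eqP->; rewrite mulgA.
Qed.

Lemma one_mulG y : one_mul y \in G.
Proof. by rewrite groupM ?(valP (quo_repr y).1) ?(valP (quo_repr y).2). Qed.

Local Notation opi u v :=
  (quo_pi (trans_equiv G G (idm_morphism G)) (u, v) : one).

Lemma one_l h u v : h \in G ->
  lact one h (opi u v) = opi (subg G h * u)%g v.
Proof. by move=> hG; apply: quo_lactE => //; exact: trans_l_subproof. Qed.

Lemma one_r g u v : g \in G ->
  ract one (opi u v) g = opi u (v * subg G g)%g.
Proof. by move=> hG; apply: quo_ractE => //; exact: trans_r_subproof. Qed.

Lemma btimes1 (X : biset G H) : biset_iso (btimes X one) X.
Proof.
pose e := trans_equiv G G (idm_morphism G).
apply: (btimes_isoP (f := fun x y => ract X x (one_mul y))).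
- move=> x y x' y'; split.
    move=> exy; exists (one_mul y' * (one_mul y)^-1)%g.
      by rewrite groupM ?groupV ?one_mulG.
    split; first by rewrite ractM ?groupV ?one_mulG // -exy ractK ?one_mulG.
    move: exy; elim/quo_ind: y => -[u v]; elim/quo_ind: y' => -[u' v'] _.
    have uG := subgP u; have vG := subgP v; have u'G := subgP u'; have v'G := subgP v'.
    rewrite !one_mulE one_l ?groupM ?groupV ?groupM //.
    apply/(quo_piP e); apply/exists_inP; exists (val v * (val v')^-1)%g.
      by rewrite groupM ?groupV.
    rewrite /= subgK ?groupM ?groupV ?groupM //.
    by apply/andP; split; apply/eqP; rewrite ?invMg ?mulgA ?mulgKV ?mulgK. 
  case=> h hG [-> ->]; elim/quo_ind: y => -[u v].
  rewrite one_l //.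
  by rewrite !one_mulE /= subgK // !ractM ?groupM ?subgP.
- move=> x; exists x, (quo_pi e (1, 1)%g).
  by rewrite one_mulE mulg1 ract1.
- by move=> h hH x y; rewrite lractA ?one_mulG.
- move=> g gG x; elim/quo_ind=> -[u v].
  rewrite one_r //.
  by rewrite !one_mulE /= subgK // !ractM ?groupM ?subgP.
Qed.
End Identity.

Section ProdTheory.
Variables (gT1 hT1 gT2 hT2 : finGroupType).
Variables (G1 : {group gT1}) (H1 : {group hT1}).
Variables (G2 : {group gT2}) (H2 : {group hT2}).
Implicit Types (X : biset G1 H1) (Y : biset G2 H2).

Lemma bprod_iso X X' Y Y' : biset_iso X X' -> biset_iso Y Y' ->
  biset_iso (bprod X Y) (bprod X' Y').
Proof.
case=> f [[f' fK f'K] fl fr] [g [[g' gK g'K] gl gr]].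
exists (fun u => (f u.1, g u.2) : bprod X' Y'); split.
- exists (fun u => (f' u.1, g' u.2) : bprod X Y) => -[x y] /=.
    by rewrite fK gK.
  by rewrite f'K g'K.
- by case=> h h' /setXP[/= hH h'H] [x y] /=; rewrite /prod_lact /= fl ?gl.
- by case=> h h' /setXP[/= hH h'H] [x y] /=; rewrite /prod_ract /= fr ?gr.
Qed.

Lemma bprod_suml X X' Y :
  biset_iso (bprod (bsum X X') Y) (bsum (bprod X Y) (bprod X' Y)).
Proof.
exists (fun u => match u.1 with
  | inl x => inl (x, u.2) | inr x => inr (x, u.2) end
  : bsum (bprod X Y) (bprod X' Y)); split.
- exists (fun u => match u with
    | inl v => (inl v.1, v.2) | inr v => (inr v.1, v.2) end
    : bprod (bsum X X') Y); first by case=> -[].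
  by case=> -[].
- by case=> h h' _ [[] x y].
- by case=> h h' _ [[] x y].
Qed.

Lemma bprod_sumr X Y Y' :
  biset_iso (bprod X (bsum Y Y')) (bsum (bprod X Y) (bprod X Y')).
Proof.
exists (fun u => match u.2 with
  | inl x => inl (u.1, x) | inr x => inr (u.1, x) end
  : bsum (bprod X Y) (bprod X Y')); split.
- exists (fun u => match u with
    | inl v => (v.1, inl v.2) | inr v => (v.1, inr v.2) end
    : bprod X (bsum Y Y')); first by case=> x [].
  by case=> -[].
- by case=> h h' _ [x [] y].
- by case=> h h' _ [x [] y].
Qed.
End ProdTheory.

Section Augmentation.
Variables (gT hT : finGroupType) (G : {group gT}) (H : {group hT}).

Definition lorbit (X : biset G H) (x : X) : {set X} :=
  [set lact X h x | h in H].

Definition norbits (X : biset G H) : nat := #|[set lorbit x | x in X]|.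

Lemma norbits_iso X Y : biset_iso X Y -> norbits X = norbits Y.
Proof.
case=> f [[g fK gK] fl fr].
have imf x : f @: lorbit x = lorbit (f x).
  by rewrite -imset_comp; apply: eq_in_imset => h hH /=; rewrite fl.
rewrite /norbits -(card_imset _ (imset_inj (can_inj fK))) -imset_comp.
congr #|pred_of_set _|; apply/setP=> B; apply/imsetP/imsetP=> -[x _ ->].
  by exists (f x); rewrite //= imf.
by exists (g x); rewrite //= imf gK.
Qed.

Lemma norbits_sum X Y : norbits (bsum X Y) = (norbits X + norbits Y)%N.
Proof.
have oX x : lorbit (X := bsum X Y) (inl x) = inl @: lorbit x.
  by rewrite -imset_comp; apply: eq_imset.
have oY y : lorbit (X := bsum X Y) (inr y) = inr @: lorbit y.
  by rewrite -imset_comp; apply: eq_imset.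
pose iX (A : {set X}) : {set bsum X Y} := inl @: A.
pose iY (A : {set Y}) : {set bsum X Y} := inr @: A.
have iXi : injective iX by apply: imset_inj => u v [].
have iYi : injective iY by apply: imset_inj => u v [].
rewrite /norbits -(card_imset _ iXi) -(card_imset _ iYi) -cardsUI.
rewrite [X in (_ + X)%N](_ : _ = 0%N) ?addn0; last first.
  apply/eqP; rewrite cards_eq0; apply/set0Pn=> -[B /setIP[]].
  case/imsetP=> _ /imsetP[x _ ->] -> /imsetP[_ /imsetP[y _ ->]] /setP/(_ (inl x)).
  rewrite imset_f; last by apply/imsetP; exists 1%g; rewrite ?lact1.
  by move/esym/imsetP=> [].
congr #|pred_of_set _|; apply/setP=> B; apply/imsetP/setUP.
  case=> -[] x _ ->; [left; rewrite oX|right; rewrite oY];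
  by apply: imset_f; apply: imset_f.
case=> /imsetP[_ /imsetP[x _ ->] ->].
  by exists (inl x) => //; rewrite oX.
by exists (inr x) => //; rewrite oY.
Qed.
End Augmentation.

Section Operations.
Variable p : nat.

Section Comp.
Variables (gT hT kT : finGroupType).
Variables (G : {group gT}) (H : {group hT}) (L : {group kT}).

(* The bilinear map such that [X] \o [Y] = [X \times_H Y]: see bcomp_bcls,   *)
(* bcomp_linearl and bcomp_linearr.                                          *)
Definition bcomp (a : burnside p H L) (b : burnside p G H) : burnside p G L :=
  blift (fun X => blift (fun Y => bcls p (btimes X Y)) b) a.

Fact btimes_additiver (X : biset H L) :
  badditive (fun Y : biset G H => bcls p (btimes X Y)).
Proof.
move=> Z Y Y' ZY; apply: bcls_sum; apply: biset_iso_trans (btimes_sumr X Y Y').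
exact: btimes_iso (biset_iso_refl X) ZY.
Qed.

Fact btimes_additivel (b : burnside p G H) :
  badditive (fun X : biset H L => blift (fun Y => bcls p (btimes X Y)) b).
Proof.
move=> Z X X' ZX; apply: (badditive_lift2 (f := fun X Y => bcls p (btimes X Y)) _ b ZX) => {ZX}Z {}X {}X' Y ZX.
apply: bcls_sum; apply: biset_iso_trans (btimes_suml X X' Y).
exact: btimes_iso ZX (biset_iso_refl Y).
Qed.

Lemma bcomp_bcls (X : biset H L) (Y : biset G H) :
  bcomp (bcls p X) (bcls p Y) = bcls p (btimes X Y).
Proof.
rewrite /bcomp blift_bcls; last exact: btimes_additivel.
exact/blift_bcls/btimes_additiver.
Qed.

Lemma bcomp_linearl b : linear (bcomp^~ b).
Proof. exact/blift_linear/btimes_additivel. Qed.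

Lemma bcomp_linearr a : linear (bcomp a).
Proof.
move=> c b b'; rewrite /bcomp !(blift_sum _ a) scaler_sumr -big_split /=.
apply: eq_bigr => X _; rewrite (blift_linear (@btimes_additiver X)) scalerDr !scalerA.
by rewrite mulrC.
Qed.
End Comp.

Section Prod.
Variables (gT1 hT1 gT2 hT2 : finGroupType).
Variables (G1 : {group gT1}) (H1 : {group hT1}).
Variables (G2 : {group gT2}) (H2 : {group hT2}).

(* The bilinear map such that [X] \times [Y] = [X \times Y].                 *)
Definition bmul (a : burnside p G1 H1) (b : burnside p G2 H2) :
    burnside p (setX_group G1 G2) (setX_group H1 H2) :=
  blift (fun X => blift (fun Y => bcls p (bprod X Y)) b) a.

Fact bprod_additiver (X : biset G1 H1) :
  badditive (fun Y : biset G2 H2 => bcls p (bprod X Y)).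
Proof.
move=> Z Y Y' ZY; apply: bcls_sum; apply: biset_iso_trans (bprod_sumr X Y Y').
exact: bprod_iso (biset_iso_refl X) ZY.
Qed.

Fact bprod_additivel (b : burnside p G2 H2) :
  badditive (fun X : biset G1 H1 => blift (fun Y => bcls p (bprod X Y)) b).
Proof.
move=> Z X X' ZX; apply: (badditive_lift2 (f := fun X Y => bcls p (bprod X Y)) _ b ZX) => {ZX}Z {}X {}X' Y ZX.
apply: bcls_sum; apply: biset_iso_trans (bprod_suml X X' Y).
exact: bprod_iso ZX (biset_iso_refl Y).
Qed.

Lemma bmul_bcls (X : biset G1 H1) (Y : biset G2 H2) :
  bmul (bcls p X) (bcls p Y) = bcls p (bprod X Y).
Proof.
rewrite /bmul blift_bcls; last exact: bprod_additivel.
exact/blift_bcls/bprod_additiver.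
Qed.

Lemma bmul_linearl b : linear (bmul^~ b).
Proof. exact/blift_linear/bprod_additivel. Qed.

Lemma bmul_linearr a : linear (bmul a).
Proof.
move=> c b b'; rewrite /bmul !(blift_sum _ a) scaler_sumr -big_split /=.
apply: eq_bigr => X _; rewrite (blift_linear (@bprod_additiver X)) scalerDr !scalerA.
by rewrite mulrC.
Qed.
End Prod.

Section Aug.
Variables (gT hT : finGroupType) (G : {group gT}) (H : {group hT}).

(* The linear map such that \epsilon([X]) = |H \ X|.                         *)
Definition baug (a : burnside p G H) : zloc p :=
  blift (fun X => (norbits X)%:R : (zloc p)^o) a.

Fact norbits_additive :
  badditive (fun X : biset G H => (norbits X)%:R : (zloc p)^o).
Proof. by move=> Z X Y /norbits_iso->; rewrite norbits_sum natrD. Qed.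

Lemma baug_bcls (X : biset G H) : baug (bcls p X) = (norbits X)%:R.
Proof. exact: (blift_bcls norbits_additive X). Qed.

Lemma baug_linear : linear (baug : _ -> (zloc p)^o).
Proof. exact: (blift_linear norbits_additive). Qed.
End Aug.

Section Basis.
Variables (gT hT : finGroupType) (G : {group gT}) (H : {group hT}).

Lemma burnside_span (a : burnside p G H) :
  in_span (fun b => exists X, b = bcls p X) a.
Proof.
rewrite -[a]breprK -[brepr a]freeg_sumE; elim: (dom _) => [|X s IHs].
  rewrite big_nil; have -> : bpi (0 : {freeg _ / _}) = 0 :> burnside p G H.
    by rewrite -(subrr 0) bpiB subrr.
  exact: in_span0.
rewrite big_cons bpiD; apply: in_spanD IHs.
rewrite (_ : << _ *g X >> = coeff X (brepr a) *: << X >>); last first.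
  by apply/eqP/freeg_eqP=> Y; rewrite coeffZ !coeffU mul1r.
rewrite bpiZ; apply/in_spanZ/in_span_gen; exists X.
exact: bpi_gen.
Qed.

(* [K, phi]_G^H, meaningful when K is contained in G and phi(K) in H *)
Definition bbas (K : {group gT}) (phi : {morphism K >-> hT}) : burnside p G H :=
  bcls p (btrans G H phi).
End Basis.
End Operations.
Arguments bbas p {gT hT} G H {K} phi.

Local Open Scope group_scope.

(* fhom Q f, for f with domain P: the restriction of f to P belongs to        *)
(* Hom_F(P, Q). This depends only on the values of f on P (fhom_ext), and     *)
(* identities are the case x = 1 of fhom_conj.                                *)
Record fusion_system (gT : finGroupType) (S : {group gT}) : Type :=
    FusionSystem {
  fhom : forall P Q : {group gT}, {morphism P >-> gT} -> Prop;
  fhom_obj : forall (P Q : {group gT}) (f : {morphism P >-> gT}),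
    fhom Q f -> [/\ P \subset S, Q \subset S, f @* P \subset Q & 'injm f];
  fhom_comp : forall (P Q R : {group gT}) (f : {morphism P >-> gT})
      (g : {morphism Q >-> gT}) (k : {morphism P >-> gT}),
    fhom Q f -> fhom R g -> {in P, forall u, k u = g (f u)} -> fhom R k;
  fhom_conj : forall (P Q : {group gT}) (f : {morphism P >-> gT}) (x : gT),
    P \subset S -> Q \subset S -> x \in S ->
    {in P, forall u, f u = x * u * x^-1} -> f @* P \subset Q -> fhom Q f;
  fhom_onto : forall (P Q : {group gT}) (f : {morphism P >-> gT}),
    fhom Q f -> fhom (f @* P)%G f;
  fhom_inv : forall (P Q : {group gT}) (f : {morphism P >-> gT})
      (g : {morphism (f @* P) >-> gT}),
    fhom Q f -> {in P, forall u, g (f u) = u} -> fhom P g }.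

Section Saturation.
Variables (p : nat) (gT : finGroupType) (S : {group gT}).
Variable F : fusion_system S.
Implicit Types P Q : {group gT}.

Lemma fhom_ext P Q (f g : {morphism P >-> gT}) :
  {in P, f =1 g} -> fhom F Q f -> fhom F Q g.
Proof.
move=> fg Ff; have [sPS sQS sfQ _] := fhom_obj Ff.
have Fid : fhom F Q (idm_morphism Q).
  apply: (@fhom_conj _ _ F Q Q (idm_morphism Q) 1) => //.
    by move=> u _; rewrite invg1 mulg1 mul1g.
  by rewrite morphim_idm.
by apply: fhom_comp Ff Fid _ => u Pu; rewrite -fg.
Qed.

Definition fconj P Q : Prop :=
  exists (f : {morphism P >-> gT}) (g : {morphism Q >-> gT}),
    [/\ fhom F Q f, fhom F P g, {in P, cancel f g} & {in Q, cancel g f}].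

Definition fully_centralized P : Prop :=
  P \subset S /\ forall Q, fconj P Q -> (#|'C_S(Q)| <= #|'C_S(P)|)%N.

Definition fully_normalized P : Prop :=
  P \subset S /\ forall Q, fconj P Q -> (#|'N_S(Q)| <= #|'N_S(P)|)%N.

(* conj_aut P x is u |-> x^-1 u x; the image is the same as for c_x. *)
Definition fAutS P : {set {perm gT}} := conj_aut P @* 'N_S(P).

Definition fAut P : {set {perm gT}} :=
  [set a in Aut P | `[< exists2 f : {morphism P >-> gT},
                          fhom F P f & {in P, f =1 a} >]].

Lemma fAut_group_set P : P \subset S -> group_set (fAut P).
Proof.
move=> sPS; apply/group_setP; split=> [|a b /setIdP[Aa /asboolP[f Ff fa]]].
  rewrite inE group1; apply/asboolP; exists (idm_morphism P).
    apply: (@fhom_conj _ _ F P P _ 1) => //; last by rewrite morphim_idm.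
    by move=> u _; rewrite invg1 mulg1 mul1g.
  by move=> u _; rewrite perm1.
case/setIdP=> Ab /asboolP[g Fg gb]; have Aab := groupM Aa Ab.
rewrite inE Aab; apply/asboolP; exists (autm_morphism Aab) => //.
apply: fhom_comp Ff Fg _ => u Pu; rewrite /= autmE permM -fa // -gb //.
by rewrite fa // Aut_closed.
Qed.

Definition extender_set P (f : {morphism P >-> gT}) : {set gT} :=
  [set x in 'N_S(P) | [exists y in 'N_S(f @* P),
    [forall u in P, f (x * u * x^-1) == y * f u * y^-1]]].

Fact extender_group_set P (f : {morphism P >-> gT}) :
  group_set (extender_set f).
Proof.
apply/group_setP; split=> [|x x' /setIdP[Nx /exists_inP[y Ny /forall_inP fx]]].
  rewrite inE group1; apply/exists_inP; exists 1; rewrite ?group1 //.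
  by apply/forall_inP=> u _; rewrite !mul1g !invg1 !mulg1.
case/setIdP=> Nx' /exists_inP[y' Ny' /forall_inP fx'].
rewrite inE groupM //; apply/exists_inP; exists (y * y'); rewrite ?groupM //.
apply/forall_inP=> u Pu; rewrite !invMg !mulgA.
have Pu' : x' * u * x'^-1 \in P.
  have -> : x' * u * x'^-1 = u ^ x'^-1 by rewrite conjgE invgK mulgA.
  by rewrite memJ_norm // groupV; case/setIP: Nx'.
have fxu := eqP (fx _ Pu'); rewrite !mulgA in fxu; rewrite fxu.
by have /eqP-> := fx' _ Pu; rewrite !mulgA.
Qed.

(* N_phi, for f = phi *)
Definition extender P (f : {morphism P >-> gT}) : {group gT} :=
  Group (extender_group_set f).

Definition saturated : Prop :=
  (forall P, fully_normalized P ->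
     fully_centralized P /\ p.-Sylow(fAut P) (fAutS P)) /\
  (forall P (f : {morphism P >-> gT}),
     fhom F S f -> fully_centralized (f @* P)%G ->
     exists2 g : {morphism (extender f) >-> gT},
       fhom F S g & {in P, g =1 f}).

Implicit Types Om : burnside p S S.

Definition fgenerated Om : Prop :=
  in_span (fun a => exists P (f : {morphism P >-> gT}),
                      fhom F S f /\ a = bbas p S S f) Om.

Definition right_stable Om : Prop :=
  forall P (f : {morphism P >-> gT}), fhom F S f ->
    bcomp Om (bbas p P S f) = bcomp Om (bbas p P S (idm_morphism P)).

Definition right_characteristic Om : Prop :=
  [/\ fgenerated Om, right_stable Om & ~ zloc_pdvd (baug Om)].
End Saturation.

Section Frobenius.
Variables (p : nat) (gT : finGroupType) (S : {group gT}).

Definition diag (x : gT) : gT * gT := (x, x).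

Fact diagM : {in S &, {morph diag : x y / x * y}}.
Proof. by []. Qed.

Definition diag_morphism : {morphism S >-> gT * gT} := Morphism diagM.

Definition bifree_element (X : burnside p S S) : Prop :=
  in_span (fun a => exists Y : biset S S, bifree Y /\ a = bcls p Y) X.

Definition frobenius_reciprocity (X : burnside p S S) : Prop :=
  let D := bbas p S (setX_group S S) diag_morphism in
  let one := bbas p S S (idm_morphism S) in
  bcomp (bmul X X) D = bcomp (bcomp (bmul X one) D) X.
End Frobenius.

(* Main.v *)
Require Import Defs.
From mathcomp Require Import all_boot all_order all_algebra all_fingroup all_solvable.
From mathcomp Require Import boolp.
(* After the group library, so that ract is the right action of a biset. *)
Import Defs.

Set Implicit Arguments.
Unset Strict Implicit.
Unset Printing Implicit Defensive.

Import GRing.Theory Num.Theory.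
Local Open Scope ring_scope.

(** Everything is read off from marks. For functions a, b from a set K to H
and G, the mark of a (G, H)-biset at (a, b) is the number of its points x with
a(u) x = x b(u) for all u in K; it extends linearly to A(G, H)_(p). An element
is determined by its marks at the pairs (f, id), f a homomorphism from a
subgroup of G to H (mark_inj), by the usual triangularity of the table of
marks; the same argument shows that it lies in the span of the classes [K, f]
for (K, f) in a family closed under subconjugation as soon as its marks vanish
outside that family (span_of_marks).

Write m(a, b) for the marks of X on a subgroup P of S. The mark of X o [P, f]
at (a, b) is m(a, f b), and computing both sides of Frobenius reciprocity at
((a, b), c) turns it into
   m(a, c) m(b, c) = m(a, b) m(b, c)
for all a, b, c. So if m(b, c) is nonzero, then m(-, c) = m(-, b). If X is a
right characteristic element of F, then m(b, id) nonzero puts b in F, because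
X is F-generated, and right stability gives m(a, id) = m(a, b): this proves
reciprocity (right_characteristic_frobenius).

Conversely, assume reciprocity. The relation m(a, b) <> 0 on homomorphisms
from P to S is then transitive, and symmetric if it is reflexive; the morphisms
of the fusion system are to be the f with m(f, id) <> 0. All that is missing
comes from one congruence (mark_extension). Let Q be normal in a
p-group T, b a homomorphism on T and a a homomorphism on Q whose composites
with conjugation by T are S-conjugate to a. Then T acts on the set of orbits
of C_S(a(Q)) on the fixed points for (a, b), and the points fixed by T are
accounted for by the homomorphisms r on T that extend a:
   m(a, b) / |C_S(a(Q))| = sum_r m(r, b) / |C_S(a(Q))|   modulo p.
For Q = 1 it says that sum_r m(r, b) / |S|, over all r from T to S, is
congruent to the augmentation, hence prime to p. Applied to X and, X being
bifree, to its opposite, this makes the relation reflexive (sim_refl).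

Call (P, f) a unit pair if m(f, id) / |C_S(f(P))| is prime to p. The
congruence extends such an f to every T that it tolerates, within the fusion
system (extend_unit_mark). Unit pairs exist since the sum over all r is
prime to p: let S x D act on Hom(P, S), D a p-group of automorphisms of P
in the fusion system; an orbit contributes a multiple of p |S| unless it
contains a unit pair (P, f) with f D f^-1 induced by S (exists_unit_orbit,
exists_unit_mark). The same count, made with the restrictions to Q of
homomorphisms on P, shows that the fusion system is closed under restriction
(restrict_sim). Saturation is then formal. For P fully normalized and D a
Sylow subgroup of Aut_F(P) containing Aut_S(P), the map f extends to N_S(P), so
it maps N_S(P) onto N_S(f(P)), whence D = Aut_S(P) and C_S(P) is carried onto
C_S(f(P)), which is as large as possible (mark_fusion_normalized). For f(P)
fully centralized one embeds N_S(f(P)) by a unit pair r, extends r f, and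
composes with r^-1 (mark_fusion_extension). *)

(** * Localized integers and linear extension from bisets *)

Section Zloc.
Variable p : nat.

Lemma zloc_mulf_eq0 (x y : zloc p) : (x * y == 0) = (x == 0) || (y == 0).
Proof.
have e0 (z : zloc p) : (z == 0) = (zloc_val z == 0) by [].
by rewrite !e0 -mulf_eq0.
Qed.

Lemma zloc_natr_val n : zloc_val (n%:R : zloc p) = n%:R.
Proof. by elim: n => // n IHn; rewrite !mulrS -IHn. Qed.

Lemma zloc_natr_eq0 n : ((n%:R : zloc p) == 0) = (n == 0)%N.
Proof. by rewrite -val_eqE /= zloc_natr_val pnatr_eq0. Qed.

Lemma zloc_mulfI (x : zloc p) : x != 0 -> injective ( *%R x).
Proof.
move=> x0 y z /eqP; rewrite -subr_eq0 -mulrBr zloc_mulf_eq0 (negPf x0) /=.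
by rewrite subr_eq0 => /eqP.
Qed.

Lemma pdvd0 : zloc_pdvd (0 : zloc p).
Proof. by exists 0; rewrite mulr0. Qed.

Lemma pdvdD (x y : zloc p) : zloc_pdvd x -> zloc_pdvd y -> zloc_pdvd (x + y).
Proof. by case=> a -> [b ->]; exists (a + b); rewrite mulrDr. Qed.

Lemma pdvdN (x : zloc p) : zloc_pdvd x -> zloc_pdvd (- x).
Proof. by case=> a ->; exists (- a); rewrite mulrN. Qed.

Lemma pdvd_mull (x y : zloc p) : zloc_pdvd y -> zloc_pdvd (x * y).
Proof. by case=> a ->; exists (x * a); rewrite mulrCA. Qed.

Lemma pdvd_congr (x y : zloc p) : zloc_pdvd (x - y) -> zloc_pdvd x <-> zloc_pdvd y.
Proof.
move=> xy; split=> [/pdvdN/(pdvdD xy)/pdvdN|/(pdvdD xy)].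
  by rewrite addrAC subrr add0r opprK.
by rewrite subrK.
Qed.

Lemma pdvd_natr_mod m n : m = n %[mod p] -> zloc_pdvd (m%:R - n%:R : zloc p).
Proof.
move=> e; exists ((m %/ p)%:R - (n %/ p)%:R).
rewrite {1}(divn_eq m p) {1}(divn_eq n p) e !natrD !natrM.
by rewrite opprD addrACA subrr addr0 mulrBr ![_%:R * p%:R]mulrC.
Qed.
End Zloc.

Lemma in_span_ind (R : pzRingType) (V : lmodType R) (B A : V -> Prop) :
    (forall v, B v -> A v) -> A 0 ->
    (forall c u v, A u -> A v -> A (c *: u + v)) ->
  forall v, in_span B v -> A v.
Proof.
move=> AB A0 AD v [s Bs ->]; elim: s Bs => [|cb s IHs] Bs.
  by rewrite big_nil.
rewrite big_cons; apply: AD; first by apply/AB/Bs/mem_head.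
by apply: IHs => u us; apply: Bs; rewrite inE us orbT.
Qed.

Lemma burnside_ind p (gT hT : finGroupType) (G : {group gT}) (H : {group hT})
    (A : burnside p G H -> Prop) :
    (forall X, A (bcls p X)) -> A 0 ->
    (forall c u v, A u -> A v -> A (c *: u + v)) ->
  forall a, A a.
Proof.
move=> AB A0 AD a.
by apply: in_span_ind (burnside_span a) => // _ [X ->].
Qed.

(** * Marks *)
Section Fixpts.
Variables (p : nat) (gT hT kT : finGroupType).
Variables (G : {group gT}) (H : {group hT}) (K : {set kT}).
Variables (a : kT -> hT) (b : kT -> gT).

(** The memberships in H and G are part of the definition: outside of them the
actions are meaningless, and with them the count is invariant under
isomorphism for arbitrary functions a and b. *)
Definition fixpts (X : biset G H) : {set X} :=
  [set x | [forall u in K, [&& a u \in H, b u \in G &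
                             lact X (a u) x == ract X x (b u)]]].

Lemma fixptsP (X : biset G H) (x : X) :
  reflect {in K, forall u, [/\ a u \in H, b u \in G &
                             lact X (a u) x = ract X x (b u)]}
          (x \in fixpts X).
Proof.
rewrite inE; apply: (iffP forall_inP) => [fx u /fx/and3P[? ? /eqP]|fx u /fx[]] //.
by move=> -> -> ->; rewrite /=.
Qed.

Lemma card_fixpts_iso X Y : biset_iso X Y -> #|fixpts X| = #|fixpts Y|.
Proof.
case=> f [[g fK gK] fl fr]; rewrite -(card_imset _ (can_inj fK)).
apply: eq_card => y; apply/imsetP/fixptsP => [[x /fixptsP fx ->] u Ku|fy].
  by have [aH bG e] := fx u Ku; rewrite -fl // -fr // e.
exists (g y); last by rewrite gK.
apply/fixptsP=> u Ku; have [aH bG e] := fy u Ku; split=> //.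
by apply: (can_inj fK); rewrite fl // fr // gK.
Qed.

Lemma fixpts_additive :
  badditive (fun X : biset G H => #|fixpts X|%:R : (zloc p)^o).
Proof.
move=> Z X Y /card_fixpts_iso->; rewrite -natrD; congr _%:R.
have inl_inj : injective (inl : X -> bsum X Y) by move=> x y [].
have inr_inj : injective (inr : Y -> bsum X Y) by move=> x y [].
rewrite -(card_imset _ inl_inj) -(card_imset _ inr_inj).
rewrite -cardsUI [X in (_ + X)%N](_ : _ = 0%N) ?addn0; last first.
  apply/eqP; rewrite cards_eq0; apply/set0Pn=> -[z /setIP[]].
  by case/imsetP=> x _ -> /imsetP[].
apply: eq_card => -[x|y]; rewrite in_setU.
  rewrite mem_imset // [X in _ || X](_ : _ = false) ?orbF; last first.
    by apply/imsetP=> -[].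
  by apply/fixptsP/fixptsP=> fx u /fx[aH bG] => [[]|] e; split=> //=; rewrite e.
rewrite mem_imset // [X in X || _](_ : _ = false) ?orFb; last first.
  by apply/imsetP=> -[].
by apply/fixptsP/fixptsP=> fx u /fx[aH bG] => [[]|] e; split=> //=; rewrite e.
Qed.

End Fixpts.
Arguments fixpts {gT hT kT G H} K a b X.

Section Marks.
Variables (p : nat) (gT hT kT : finGroupType).
Variables (G : {group gT}) (H : {group hT}).

(** Keeping the two homomorphisms symmetric, instead of only counting fixed
points of graphs {(a(u), u)}, makes Frobenius reciprocity an identity between
marks without any injectivity assumption or inverse. The definition is locked
because unification would otherwise unfold it when it compares marks. *)
Definition mark : {set kT} -> (kT -> hT) -> (kT -> gT) -> burnside p G H -> zloc p :=
  locked (fun K a b => blift (fun X => #|fixpts K a b X|%:R : (zloc p)^o)).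

Variables (K : {set kT}) (a : kT -> hT) (b : kT -> gT).

Lemma mark_bcls X : mark K a b (bcls p X) = #|fixpts K a b X|%:R.
Proof. by rewrite /mark -lock; apply: blift_bcls (fixpts_additive p K a b) X. Qed.

Lemma mark_linear : linear (mark K a b : _ -> (zloc p)^o).
Proof. by rewrite /mark -lock; apply: (blift_linear (fixpts_additive p K a b)). Qed.

Lemma mark_lin c x y : mark K a b (c *: x + y) = c * mark K a b x + mark K a b y.
Proof. exact: mark_linear. Qed.

Lemma mark0 : mark K a b 0 = 0.
Proof. by have := mark_lin (-1) 0 0; rewrite scaler0 addr0 mulN1r addNr. Qed.

Lemma markD x y : mark K a b (x + y) = mark K a b x + mark K a b y.
Proof. by rewrite -[x]scale1r mark_lin mul1r scale1r. Qed.
End Marks.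
Arguments mark {p gT hT kT G H} K a b x.

Section MarkTheory.
Variables (p : nat) (gT hT : finGroupType) (G : {group gT}) (H : {group hT}).
Implicit Types X : biset G H.

Lemma eq_fixpts (kT : finGroupType) (K : {set kT}) (a a' : kT -> hT) (b b' : kT -> gT) X :
  {in K, a =1 a'} -> {in K, b =1 b'} -> fixpts K a b X = fixpts K a' b' X.
Proof.
move=> ea eb; apply/setP=> x; rewrite !inE; apply: eq_forallb_in => u Ku.
by rewrite ea // eb.
Qed.

Lemma eq_mark (kT : finGroupType) (K : {set kT}) (a a' : kT -> hT) (b b' : kT -> gT)
    (x : burnside p G H) :
  {in K, a =1 a'} -> {in K, b =1 b'} -> mark K a b x = mark K a' b' x.
Proof.
move=> ea eb; elim/burnside_ind: x => [X||c u v IHu IHv].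
- by rewrite !mark_bcls (eq_fixpts _ ea eb).
- by rewrite !mark0.
- by rewrite !mark_lin IHu IHv.
Qed.

(** Only the pairs (a(u), b(u)) matter, so marks can be transported along any
reparametrization of K. *)
Lemma mark_imset (kT lT : finGroupType) (K : {set kT}) (f : kT -> lT)
    (a : lT -> hT) (b : lT -> gT) (x : burnside p G H) :
  mark (f @: K) a b x = mark K (a \o f) (b \o f) x.
Proof.
elim/burnside_ind: x => [X||c u v IHu IHv].
- rewrite !mark_bcls; congr _%:R; apply: eq_card => x.
  apply/fixptsP/fixptsP=> fx u => [Ku|/imsetP[v Kv ->]]; last exact: fx.
  exact: fx (imset_f f Ku).
- by rewrite !mark0.
- by rewrite !mark_lin IHu IHv.
Qed.

(** Left translation by h matches the fixed points for a with those for a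
followed by conjugation by h. *)
Lemma mark_conjl (kT : finGroupType) (K : {set kT}) (a : kT -> hT) (b : kT -> gT)
    (h : hT) (x : burnside p G H) : h \in H ->
  mark K (fun u => (a u ^ h)%g) b x = mark K a b x.
Proof.
move=> hH; elim/burnside_ind: x => [X||c u v IHu IHv].
- rewrite !mark_bcls; congr _%:R.
  have inj : injective (lact X h) by move=> x y e; rewrite -(lactK x hH) e lactK.
  rewrite -(card_imset _ inj); apply: eq_card => x.
  apply/imsetP/fixptsP=> [[y /fixptsP fy ->] u Ku|fx].
    have [] := fy u Ku; rewrite groupJr // => aH bG e; split=> //.
    by rewrite lractA // -e conjgE !lactM ?groupM ?groupV // lactKV.
  exists (lact X h^-1%g x); last by rewrite lactKV.
  apply/fixptsP=> u Ku; have [aH bG e] := fx u Ku.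
  rewrite groupJr //; split=> //.
  by rewrite lractA ?groupV // -e conjgE !lactM ?groupM ?groupV // lactKV.
- by rewrite !mark0.
- by rewrite !mark_lin IHu IHv.
Qed.
End MarkTheory.

(** * Marks of composites and products; Frobenius reciprocity *)
Section Restriction.
Variables (gT hT kT : finGroupType).
Variables (G : {group gT}) (H : {group hT}) (L : {group kT}).
Variables (f : {morphism G >-> hT}) (sfGH : (f @* G)%g \subset H) (X : biset H L).

Let fG : {in G, forall g, f g \in H}.
Proof. by move=> g Gg; apply: (subsetP sfGH); apply: mem_morphim. Qed.

Fact bres_subproof :
  biset_axioms G L (lact X) (fun x g => ract X x (f g)).
Proof.
split=> [x|h k hL kL x|x|g k gG kG x|h g hL gG x|h hL x].
- exact: lact1.
- exact: lactM.
- by rewrite morph1 ract1.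
- by rewrite morphM // ractM ?fG.
- by rewrite lractA ?fG.
- exact: lact_free.
Qed.

(** Composing X with [G, f] restricts its right action along f. *)
Definition bres : biset G L := Biset (BisetOn bres_subproof).

Local Notation T := (btrans G H f).
Local Notation tr := (trans_equiv G H f).

(** When K is all of G, the biset (H x G)/~ is just H, with G acting through f;
this is the identification (x, y) |-> x f(y). *)
Definition trans_mul : T -> hT :=
  locked (fun y : T => val (quo_repr y).1 * f (val (quo_repr y).2))%g.

Lemma trans_mulE u v : trans_mul (quo_pi tr (u, v)) = (val u * f (val v))%g.
Proof.
rewrite /trans_mul -lock; set w := quo_repr _.
have /(quo_piP tr)/exists_inP[k kG] : quo_pi tr w = quo_pi tr (u, v).
  exact: quo_reprK.
case/andP=> /= /eqP-> /eqP->.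
by rewrite morphM ?subgP // mulgA.
Qed.

Lemma trans_mulH y : trans_mul y \in H.
Proof. by rewrite /trans_mul -lock groupM ?fG ?subgP. Qed.

Lemma trans_mulP y y' : trans_mul y = trans_mul y' <-> y = y'.
Proof.
split=> [|-> //]; elim/quo_ind: y => -[u v]; elim/quo_ind: y' => -[u' v'].
rewrite !trans_mulE => e; apply/(quo_piP tr)/exists_inP.
exists (val v' * (val v)^-1)%g; first by rewrite groupM ?groupV ?subgP.
rewrite /= mulgKV eqxx andbT morphM ?groupV ?subgP // mulgA -e.
by rewrite morphV ?subgP // mulgK.
Qed.

Lemma trans_mul_l h y : h \in H -> trans_mul (lact T h y) = (h * trans_mul y)%g.
Proof.
move=> hH; elim/quo_ind: y => -[u v].
have -> : lact T h (quo_pi tr (u, v)) = quo_pi tr ((subg H h * u)%g, v).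
  by apply: quo_lactE => //; exact: trans_l_subproof.
by rewrite !trans_mulE /= subgK // mulgA.
Qed.

Lemma trans_mul_r g y : g \in G -> trans_mul (ract T y g) = (trans_mul y * f g)%g.
Proof.
move=> gG; elim/quo_ind: y => -[u v].
have -> : ract T (quo_pi tr (u, v)) g = quo_pi tr (u, (v * subg G g)%g).
  by apply: quo_ractE => //; exact: trans_r_subproof.
by rewrite !trans_mulE /= subgK // morphM ?subgP // mulgA.
Qed.

Lemma trans_mul_surj h : h \in H -> exists y, trans_mul y = h.
Proof.
by move=> hH; exists (quo_pi tr (subg H h, 1%g)); rewrite trans_mulE subgK ?morph1 ?mulg1.
Qed.

Lemma btimes_trans : biset_iso (btimes X T) bres.
Proof.
apply: (btimes_isoP (f := fun x y => ract X x (trans_mul y) : bres)).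
- move=> x y x' y'; split=> [e|[h hH [-> ->]]]; last first.
    by rewrite trans_mul_l // (ractM hH (trans_mulH y)).
  exists (trans_mul y' * (trans_mul y)^-1)%g.
    by rewrite groupM ?groupV ?trans_mulH.
  split; first by rewrite ractM ?groupV ?trans_mulH // -e ractK ?trans_mulH.
  apply/trans_mulP; rewrite trans_mul_l ?mulgKV //.
  by rewrite groupM ?groupV ?trans_mulH.
- move=> x; have [y yE] := trans_mul_surj (group1 H).
  by exists x, y; rewrite yE ract1.
- by move=> l lL x y /=; rewrite lractA ?trans_mulH.
- move=> g gG x y; rewrite trans_mul_r //=.
  by rewrite (ractM (trans_mulH y) (fG gG)).
Qed.
End Restriction.

(** Bilinear maps on Burnside modules are compared on classes of bisets. *)
Lemma burnside_bilinear_ext p (gT hT kT lT : finGroupType) (G : {group gT}) (H : {group hT})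
    (K : {group kT}) (L : {group lT})
    (A B : burnside p G H -> burnside p K L -> zloc p) :
    (forall c x x' y, A (c *: x + x') y = c * A x y + A x' y) ->
    (forall c x y y', A x (c *: y + y') = c * A x y + A x y') ->
    (forall c x x' y, B (c *: x + x') y = c * B x y + B x' y) ->
    (forall c x y y', B x (c *: y + y') = c * B x y + B x y') ->
    (forall X Y, A (bcls p X) (bcls p Y) = B (bcls p X) (bcls p Y)) ->
  forall x y, A x y = B x y.
Proof.
move=> Al Ar Bl Br AB x y.
have l0 (C : burnside p G H -> burnside p K L -> zloc p) v :
  (forall c x x' y, C (c *: x + x') y = c * C x y + C x' y) -> C 0 v = 0.
  by move=> Cl; have := Cl (-1) 0 0 v; rewrite scaler0 addr0 mulN1r addNr.
have r0 (C : burnside p G H -> burnside p K L -> zloc p) v :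
  (forall c x y y', C x (c *: y + y') = c * C x y + C x y') -> C v 0 = 0.
  by move=> Cl; have := Cl (-1) v 0 0; rewrite scaler0 addr0 mulN1r addNr.
elim/burnside_ind: x => [X||c u v IHu IHv]; last 1 first.
- by rewrite Al Bl IHu IHv.
- elim/burnside_ind: y => [Y||c u v IHu IHv] //.
    by rewrite (r0 A) ?(r0 B).
  by rewrite Ar Br IHu IHv.
- by rewrite (l0 A) ?(l0 B).
Qed.

Section MarkOperations.
Variable p : nat.

Lemma mark_bcomp_trans (gT hT kT lT : finGroupType) (G : {group gT}) (H : {group hT})
    (L : {group kT}) (f : {morphism G >-> hT}) (K : {set lT}) (a : lT -> kT)
    (b : lT -> gT) (x : burnside p H L) :
    (f @* G)%g \subset H -> {in K, forall u, b u \in G} ->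
  mark K a b (bcomp x (bbas p G H f)) = mark K a (f \o b) x.
Proof.
move=> sfGH bG; elim/burnside_ind: x => [X||c u v IHu IHv].
- rewrite bcomp_bcls !mark_bcls (card_fixpts_iso _ _ _ (btimes_trans sfGH X)).
  congr _%:R; apply: eq_card => x; apply/fixptsP/fixptsP=> fx u Ku.
    have [aL _ /= e] := fx u Ku; split=> //=.
    by apply: (subsetP sfGH); rewrite mem_morphim ?bG.
  by have [aL _ e] := fx u Ku; split=> //; apply: bG.
- have -> : bcomp 0 (bbas p G H f) = 0 :> burnside p G L.
    have := @bcomp_linearl p _ _ _ G H L (bbas p G H f) (-1) 0 0.
    by rewrite /= scaler0 addr0 scaleN1r addNr.
  by rewrite !mark0.
- by have -> := bcomp_linearl (bbas p G H f) c u v; rewrite !mark_lin IHu IHv.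
Qed.

Lemma mark_bmul (gT1 hT1 gT2 hT2 kT : finGroupType) (G1 : {group gT1})
    (H1 : {group hT1}) (G2 : {group gT2}) (H2 : {group hT2}) (K : {set kT})
    (a1 : kT -> hT1) (a2 : kT -> hT2) (b1 : kT -> gT1) (b2 : kT -> gT2)
    (x : burnside p G1 H1) (y : burnside p G2 H2) :
  mark K (fun u => (a1 u, a2 u)) (fun u => (b1 u, b2 u)) (bmul x y) =
  mark K a1 b1 x * mark K a2 b2 y.
Proof.
move: x y; apply: burnside_bilinear_ext => [c x x' y|c x y y'|c x x' y|c x y y'|X Y].
- by have -> := bmul_linearl y c x x'; rewrite mark_lin.
- by have -> := bmul_linearr x c y y'; rewrite mark_lin.
- by rewrite mark_lin mulrDl mulrA.
- by rewrite mark_lin mulrDr mulrCA.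
rewrite bmul_bcls !mark_bcls -natrM -cardsX; congr _%:R; apply: eq_card => -[x y].
apply/fixptsP/setXP=> /= [fxy|[/fixptsP fx /fixptsP fy] u Ku].
  split; apply/fixptsP=> u Ku; have [] := fxy u Ku;
  by rewrite !in_setX => /andP[? ?] /andP[? ?] [].
have [? ? ex] := fx u Ku; have [? ? ey] := fy u Ku.
by rewrite !in_setX /=; split; [apply/andP|apply/andP|congr (_, _)].
Qed.

Section Frobenius.
Variables (gT : finGroupType) (S : {group gT}).

Lemma diag_sub : (diag_morphism S @* S)%g \subset setX_group S S.
Proof. by apply/subsetP=> _ /morphimP[x _ Sx ->]; rewrite in_setX Sx. Qed.

Lemma idm_sub : (idm_morphism S @* S)%g \subset S.
Proof. by rewrite /= morphim_idm. Qed.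

(** The right-hand side of reciprocity, (Y x 1) o [S, Diag] o Z, is represented
by pairs (y, z) with the right action on z alone: the middle factor of a triple
(y, s, z) is absorbed by (y, s, z) ~ (y s^-1, 1, s z), and this makes the left
action of (h, h') send (y, z) to (h y h'^-1, h' z). *)
Section Twist.
Variables Y Z : biset S S.

Definition twist_lact (h : gT * gT) (u : Y * Z) : Y * Z :=
  (ract Y (lact Y h.1 u.1) h.2^-1%g, lact Z h.2 u.2).
Definition twist_ract (u : Y * Z) (g : gT) : Y * Z := (u.1, ract Z u.2 g).

Fact twist_subproof : biset_axioms S (setX_group S S) twist_lact twist_ract.
Proof.
rewrite /twist_lact /twist_ract; split.
- by case=> y z /=; rewrite invg1 ract1 !lact1.
- move=> [h h'] [k k'] /setXP[/= ? ?] /setXP[/= ? ?] [x y] /=.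
  by rewrite invMg !(lactM, ractM, lractA) ?groupM ?groupV.
- by case=> y z /=; rewrite ract1.
- by move=> g k gS kS [y z] /=; rewrite ractM.
- by move=> [h h'] g /setXP[/= ? ?] gS [y z] /=; rewrite (lractA (X := Z)).
- move=> [h h'] /setXP[/= hS h'S] [y z] /= [] ey /(lact_free h'S) h'1.
  by move: ey; rewrite h'1 invg1 ract1 => /(lact_free hS)->.
Qed.

Definition btwist : biset S (setX_group S S) := Biset (BisetOn twist_subproof).

Local Notation one := (btrans S S (idm_morphism S)).
Local Notation om := (@trans_mul _ _ S S (idm_morphism S)).

Lemma btwist_iso :
  biset_iso (btimes (btimes (bprod Y one) (btrans S (setX_group S S) (diag_morphism S))) Z)
            btwist.
Proof.
apply: biset_iso_trans (btimes_iso (btimes_trans diag_sub _) (biset_iso_refl _)) _.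
have omS o : om o \in S := trans_mulH idm_sub o.
apply: (btimes_isoP (f := fun (w : bres diag_sub (bprod Y one)) z =>
  (ract Y w.1 (om w.2)^-1%g, lact Z (om w.2) z) : btwist)).
- move=> [y o] z [y' o'] z' /=; split=> [[ey ez]|[h hS [[-> ->] ->]]].
    exists ((om o')^-1 * om o)%g; first by rewrite groupM ?groupV ?omS.
    split; last by rewrite lactM ?groupV ?omS // ez lactK ?omS.
    rewrite /prod_ract /=; congr (_, _).
      by rewrite ractM ?groupV ?omS // -ey ractKV ?omS.
    have hS : ((om o')^-1 * om o)%g \in S by rewrite groupM ?groupV ?omS.
    by apply/trans_mulP; rewrite (trans_mul_r o' hS) /= mulKVg.
  rewrite (trans_mul_r o' hS) invMg ractM ?groupV ?omS // ractK //.
  by rewrite lactM ?omS.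
- move=> [y z]; have [o oE] := trans_mul_surj (idm_morphism S) (group1 S).
  by exists (y, o), z; rewrite /= oE invg1 ract1 lact1.
- move=> [h h'] /setXP[/= hS h'S] [y o] z /=; rewrite trans_mul_l //.
  rewrite /twist_lact /=.
  by rewrite invMg !(lactM, ractM, lractA) ?groupM ?groupV ?omS.
- by move=> g gS [y o] z /=; rewrite /twist_ract /= lractA ?omS.
Qed.
End Twist.

Lemma mark_frobenius_l (kT : finGroupType) (K : {set kT}) (a b c : kT -> gT)
    (x y : burnside p S S) : {in K, forall u, c u \in S} ->
  mark K (fun u => (a u, b u)) c
    (bcomp (bmul x y) (bbas p S (setX_group S S) (diag_morphism S))) =
  mark K a c x * mark K b c y.
Proof.
by move=> cS; rewrite mark_bcomp_trans ?diag_sub // mark_bmul.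
Qed.

Lemma mark_frobenius_r (kT : finGroupType) (K : {set kT}) (a b c : kT -> gT)
    (x y : burnside p S S) :
  mark K (fun u => (a u, b u)) c
    (bcomp (bcomp (bmul x (bbas p S S (idm_morphism S)))
                  (bbas p S (setX_group S S) (diag_morphism S))) y) =
  mark K a b x * mark K b c y.
Proof.
move: x y; apply: burnside_bilinear_ext => [d x x' y|d x y y'|d x x' y|d x y y'|Y Z].
- have -> := bmul_linearl (bbas p S S (idm_morphism S)) d x x'.
  by rewrite 2!bcomp_linearl mark_lin.
- by rewrite bcomp_linearr mark_lin.
- by rewrite mark_lin mulrDl mulrA.
- by rewrite mark_lin mulrDr mulrCA.
rewrite bmul_bcls !bcomp_bcls !mark_bcls (card_fixpts_iso _ _ _ (btwist_iso Y Z)).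
rewrite -natrM -cardsX; congr _%:R; apply: eq_card => -[y z].
apply/fixptsP/setXP=> /= [fxy|[/fixptsP fy /fixptsP fz] u Ku].
  split; apply/fixptsP=> u Ku; have [] := fxy u Ku;
  rewrite !in_setX => /andP[/= aS bS] cS [] ey ez; split=> //.
  by rewrite -{2}ey ractKV.
have [? ? ey] := fy u Ku; have [? ? ez] := fz u Ku.
rewrite !in_setX /=; split; [exact/andP|by []|congr (_, _)] => //=.
by rewrite /= ey ractK.
Qed.

(** Both sides are evaluated at the pair ((a, b), c). *)
Lemma frobenius_mark (X : burnside p S S) : frobenius_reciprocity X ->
  forall (kT : finGroupType) (K : {set kT}) (a b c : kT -> gT),
    {in K, forall u, c u \in S} ->
  mark K a c X * mark K b c X = mark K a b X * mark K b c X.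
Proof.
move=> FR kT K a b c cS.
by rewrite -mark_frobenius_l // FR mark_frobenius_r.
Qed.
End Frobenius.
End MarkOperations.

(** * Elements are determined by their marks *)
Section Orbits.
Variables (gT hT : finGroupType) (G : {group gT}) (H : {group hT}).
Implicit Types X : biset G H.

(** The orbit-stabilizer theorem for bisets; the stabilizer of x0 under
H x G is the graph of f. *)
Lemma transitive_biset_iso X (x0 : X) (K : {group gT}) (f : {morphism K >-> hT}) :
    {in H & G, forall h g, lact X h x0 = ract X x0 g <-> g \in K /\ h = f g} ->
    (forall x, exists h g, [/\ h \in H, g \in G & x = lact X h (ract X x0 g)]) ->
  biset_iso (btrans G H f) X.
Proof.
move=> stab trans.
apply: (@bquo_iso _ _ _ _ _ _ (@trans_l_subproof _ _ G H K f)
  (@trans_r_subproof _ _ G H K f) (@trans_free_subproof _ _ G H K f)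
  X (fun u => lact X (val u.1) (ract X x0 (val u.2)))) => [[h g] [h' g']|x|h hH [h' g']|g gG [h' g']] /=.
- have [[[hH gG] h'H] g'G] := (subgP h, subgP g, subgP h', subgP g').
  have kH : ((val h')^-1 * val h)%g \in H by rewrite groupM ?groupV.
  have kG : (val g' * (val g)^-1)%g \in G by rewrite groupM ?groupV.
  have [st1 st2] := stab _ _ kH kG.
  split=> [/exists_inP[k kK /= /andP[/eqP eh /eqP eg]]|e].
    have := st2; rewrite /= eg mulgK eh mulKg => /(_ (conj kK erefl)) {}st2.
    have {}kG : k \in G by rewrite -(mulgK (sgval g) k) -eg.
    have {}kH : f k \in H by rewrite -(mulKg (sgval h') (f k)) -eh.
    by rewrite ractM // -st2 lactM // lractA.
  have [|kK eh] := st1.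
    rewrite lactM ?groupV // ractM ?groupV //.
    have -> : ract X x0 (val g') = lact X (val h')^-1%g (lact X (val h) (ract X x0 (val g))).
      by rewrite e lactK.
    by rewrite -!lractA ?groupV // ractK.
  apply/exists_inP; exists (val g' * (val g)^-1)%g => //=.
  by rewrite -eh mulKVg mulgKV !eqxx.
- have [h [g [hH gG ->]]] := trans x.
  by exists (subg H h, subg G g); rewrite /= !subgK.
- by rewrite subgK // lactM ?subgP.
- by rewrite subgK // ractM ?subgP // lractA ?subgP.
Qed.

(** Invariant subsets as bisets. The actions of elements outside H and G may
leave the subset, and are replaced by the identity there. *)
Section SubBiset.
Variables (X : biset G H) (A : {set X}).
Hypotheses (Al : {in H & A, forall h x, lact X h x \in A})
           (Ar : {in G & A, forall g x, ract X x g \in A}).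

Definition sub_lact (h : hT) (u : {x | x \in A}) := insubd u (lact X h (val u)).
Definition sub_ract (u : {x | x \in A}) (g : gT) := insubd u (ract X (val u) g).

Lemma val_sub_lact h u : h \in H -> val (sub_lact h u) = lact X h (val u).
Proof. by move=> hH; rewrite val_insubd Al ?(valP u). Qed.

Lemma val_sub_ract g u : g \in G -> val (sub_ract u g) = ract X (val u) g.
Proof. by move=> gG; rewrite val_insubd Ar ?(valP u). Qed.

Fact sub_subproof : biset_axioms G H sub_lact sub_ract.
Proof.
split=> [x|h k hH kH x|x|g k gG kG x|h g hH gG x|h hH x].
- by apply: val_inj; rewrite val_sub_lact ?lact1.
- by apply: val_inj; rewrite !val_sub_lact ?groupM ?lactM.
- by apply: val_inj; rewrite val_sub_ract ?ract1.
- by apply: val_inj; rewrite !val_sub_ract ?groupM ?ractM.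
- by apply: val_inj; rewrite val_sub_ract ?val_sub_lact ?val_sub_ract ?lractA.
- by move/(congr1 val); rewrite val_sub_lact // => /lact_free->.
Qed.

Definition bsub : biset G H := Biset (BisetOn sub_subproof).
End SubBiset.

Lemma bsub_split X (A : {set X})
    (Al : {in H & A, forall h x, lact X h x \in A})
    (Ar : {in G & A, forall g x, ract X x g \in A})
    (Bl : {in H & ~: A, forall h x, lact X h x \in ~: A})
    (Br : {in G & ~: A, forall g x, ract X x g \in ~: A}) :
  biset_iso X (bsum (bsub Al Ar) (bsub Bl Br)).
Proof.
apply: biset_iso_sym.
exists (fun u : bsum (bsub Al Ar) (bsub Bl Br) =>
  match u with inl x => val x | inr x => val x end); split=> [|h hH|g gG].
- apply: inj_card_bij => [[x|x] [y|y]|].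
  + by move/val_inj->.
  + by move=> e; have := valP y; rewrite -e inE (valP x).
  + by move=> e; have := valP x; rewrite e inE (valP y).
  + by move/val_inj->.
  by rewrite [leqRHS]card_sum !card_sig -(cardsC A) leq_add.
- by case=> x /=; rewrite val_sub_lact.
- by case=> x /=; rewrite val_sub_ract.
Qed.

(** For a point x of X, the subgroup of the g in G that preserve the H-orbit of
x, with the homomorphism into H describing x g = f(g) x. *)
Section Stabilizer.
Variables (X : biset G H) (x : X).

Definition stab_set : {set gT} :=
  [set g in G | [exists h in H, lact X h x == ract X x g]].

Definition stab_fun (g : gT) : hT :=
  odflt 1%g [pick h in H | lact X h x == ract X x g].

Lemma stab_funP h g : h \in H -> lact X h x = ract X x g -> h = stab_fun g.
Proof.
move=> hH e; rewrite /stab_fun; case: pickP => [k /andP[kH /eqP e']|/(_ h)]; last first.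
  by rewrite hH e eqxx.
apply/eqP; rewrite eq_sym eq_mulVg1; apply/eqP; apply: (@lact_free _ _ _ _ X _ _ x).
  by rewrite groupM ?groupV.
by rewrite lactM ?groupV // e -e' lactK.
Qed.

Lemma stab_funE g : g \in stab_set ->
  [/\ g \in G, stab_fun g \in H & lact X (stab_fun g) x = ract X x g].
Proof.
case/setIdP=> gG /exists_inP[h hH /eqP e].
by rewrite -(stab_funP hH e).
Qed.

Lemma stab_setP g h : g \in G -> h \in H -> lact X h x = ract X x g -> g \in stab_set.
Proof. by move=> gG hH e; rewrite inE gG; apply/exists_inP; exists h; rewrite ?e. Qed.

Lemma stab_mul g k : g \in stab_set -> k \in stab_set ->
  lact X (stab_fun g * stab_fun k)%g x = ract X x (g * k)%g.
Proof.
move=> /stab_funE[gG sgH eg] /stab_funE[kG skH ek].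
by rewrite lactM // ek -lractA // eg ractM.
Qed.

Fact stab_group_set : group_set stab_set.
Proof.
apply/group_setP; split=> [|g k gS kS].
  by apply: (@stab_setP _ 1%g); rewrite ?group1 ?lact1 ?ract1.
have [gG sgH _] := stab_funE gS; have [kG skH _] := stab_funE kS.
by apply: stab_setP (stab_mul gS kS); rewrite groupM.
Qed.

Definition stab_group : {group gT} := Group stab_group_set.

Fact stab_morph : {in stab_group &, {morph stab_fun : g k / (g * k)%g}}.
Proof.
move=> g k gS kS.
have [gG sgH _] := stab_funE gS; have [kG skH _] := stab_funE kS.
by apply/esym/stab_funP/(stab_mul gS kS); rewrite groupM.
Qed.

Definition stab_morphism : {morphism stab_group >-> hT} := Morphism stab_morph.

Lemma stab_sub : stab_group \subset G.
Proof. by apply/subsetP=> g /setIdP[]. Qed.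

Lemma stab_im : (stab_morphism @* stab_group)%g \subset H.
Proof. by apply/subsetP=> _ /morphimP[g _ /stab_funE[_ ? _] ->]. Qed.
End Stabilizer.

Definition graph_index : Type :=
  {K : {group gT} & {f : {morphism K >-> hT} | K \subset G /\ (f @* K)%g \subset H}}.

Definition bgraph p (i : graph_index) : burnside p G H := bbas p G H (sval (tagged i)).

(** A biset splits into transitive ones, by induction on its cardinality. *)
Lemma graph_expansion p (a : burnside p G H) :
  exists n (c : 'I_n -> zloc p) (e : 'I_n -> graph_index),
    a = \sum_i c i *: bgraph p (e i).
Proof.
elim/burnside_ind: a => [X||d u v [n [c [e ->]]] [m [c' [e' ->]]]].
- have [k] := ubnP #|X|; elim: k => // k IHk in X *; rewrite ltnS => leXk.
  have [/card0_eq X0|] := posnP #|X|.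
    have iso : biset_iso X (bsum X X).
      exists (fun x : X => inl x : bsum X X); split=> //.
      exists (fun u : bsum X X => match u with inl x => x | inr x => x end) => //.
      by case=> x; have := X0 x; rewrite inE.
    have -> : bcls p X = 0.
      by apply: (addrI (bcls p X)); rewrite addr0 -(bcls_sum p iso).
    by exists 0%N, (fun=> 0), (fun i : 'I_0 => match notF (ltn_ord i) with end); rewrite big_ord0.
  case/card_gt0P=> x _.
  pose A : {set X} := [set y | [exists h in H, exists g in G, y == lact X h (ract X x g)]].
  have AP y : reflect (exists h g, [/\ h \in H, g \in G & y = lact X h (ract X x g)]) (y \in A).
    rewrite inE; apply: (iffP exists_inP) => [[h hH /exists_inP[g gG /eqP->]]|[h [g [hH gG ->]]]].
      by exists h, g.
    by exists h => //; apply/exists_inP; exists g.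
  have Al : {in H & A, forall h y, lact X h y \in A}.
    move=> l y lH /AP[h [g [hH gG ->]]]; apply/AP; exists (l * h)%g, g.
    by rewrite groupM // lactM.
  have Ar : {in G & A, forall g y, ract X y g \in A}.
    move=> l y lG /AP[h [g [hH gG ->]]]; apply/AP; exists h, (g * l)%g.
    by rewrite groupM // lractA // ractM.
  have Bl : {in H & ~: A, forall h y, lact X h y \in ~: A}.
    move=> h y hH; rewrite !in_setC; apply: contra => yA.
    by rewrite -(lactK y hH) Al ?groupV.
  have Br : {in G & ~: A, forall g y, ract X y g \in ~: A}.
    move=> g y gG; rewrite !in_setC; apply: contra => yA.
    by rewrite -(ractK y gG) Ar ?groupV.
  rewrite (bcls_sum p (bsub_split Al Ar Bl Br)).
  have xA : x \in A by apply/AP; exists 1%g, 1%g; rewrite !group1 lact1 ract1.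
  have cX : #|X| = (#|A| + #|~: A|)%N by rewrite cardsC.
  have [|n [c [e ->]]] := IHk (bsub Bl Br).
    rewrite card_sig (leq_trans _ leXk) // cX -[ltnLHS]add0n ltn_add2r.
    by apply/card_gt0P; exists x.
  pose i0 : graph_index := existT _ (stab_group x) (exist _ (stab_morphism x) (conj (stab_sub x) (stab_im x))).
  exists n.+1, (fun i => if unlift ord0 i is Some j then c j else 1).
  exists (fun i => if unlift ord0 i is Some j then e j else i0).
  rewrite big_ord_recl unlift_none scale1r; congr (_ + _); last first.
    by apply: eq_bigr => i _; rewrite liftK.
  apply/esym/bcls_iso; apply: (transitive_biset_iso (X := bsub Al Ar) (x0 := exist _ x xA)) => [h g hH gG|y].
    split=> [/(congr1 val)|[gS ->]].
      rewrite val_sub_lact // val_sub_ract // => e'.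
      by split; [apply: stab_setP e' | apply: stab_funP].
    have [_ sH e'] := stab_funE gS; apply: val_inj.
    by rewrite val_sub_lact // val_sub_ract.
  have /AP[h [g [hH gG e']]] := valP y; exists h, g; split=> //.
  by apply: val_inj; rewrite val_sub_lact // val_sub_ract.
- by exists 0%N, (fun=> 0), (fun i : 'I_0 => match notF (ltn_ord i) with end); rewrite big_ord0.
- exists (n + m)%N, (fun i => match split i with inl j => d * c j | inr j => c' j end).
  exists (fun i => match split i with inl j => e j | inr j => e' j end).
  rewrite big_split_ord scaler_sumr; congr (_ + _); apply: eq_bigr => i _.
    by rewrite (unsplitK (inl i)) scalerA.
  by rewrite (unsplitK (inr i)).
Qed.
End Orbits.

Section MarkSpan.
Variables (p : nat) (gT hT : finGroupType) (G : {group gT}) (H : {group hT}).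

Lemma mark_sum (kT : finGroupType) (K : {set kT}) (a : kT -> hT) (b : kT -> gT)
    (I : Type) (r : seq I) (P : pred I) (c : I -> zloc p) (x : I -> burnside p G H) :
  mark K a b (\sum_(i <- r | P i) c i *: x i) = \sum_(i <- r | P i) c i * mark K a b (x i).
Proof.
elim/big_rec2: _ => [|i y z _ <-]; first exact: mark0.
by rewrite mark_lin.
Qed.

(** A fixed point in a transitive biset exhibits a subconjugation of graphs. *)
Lemma mark_bbas_neq0 (K L : {group gT}) (f : {morphism L >-> hT}) (a : gT -> hT) :
  mark K a id (bbas p G H f) != 0 ->
  exists x y, [/\ x \in H, y \in G &
    {in K, forall u, (u ^ y)%g \in L /\ a u = (f (u ^ y) ^ x)%g}].
Proof.
rewrite mark_bcls zloc_natr_eq0 -lt0n => /card_gt0P[t tf].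
elim/quo_ind: t tf => -[x y] /fixptsP fxy.
exists (val x)^-1%g, (val y)^-1%g; rewrite !groupV; split; rewrite ?subgP // => u Ku.
have [aH uG] := fxy u Ku.
have -> : lact (btrans G H f) (a u) (quo_pi (trans_equiv G H f) (x, y)) =
          quo_pi (trans_equiv G H f) ((subg H (a u) * x)%g, y).
  by apply: quo_lactE => //; exact: trans_l_subproof.
have -> : ract (btrans G H f) (quo_pi (trans_equiv G H f) (x, y)) u =
          quo_pi (trans_equiv G H f) (x, (y * subg G u)%g).
  by apply: quo_ractE => //; exact: trans_r_subproof.
move/(quo_piP (trans_equiv G H f))/exists_inP=> [k Lk /= /andP[/eqP ex /eqP ey]].
move: ex ey; rewrite !subgK // => ex ey.
have uy : (u ^ (sgval y)^-1)%g = k by rewrite conjgE invgK mulgA ey mulgK.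
by rewrite uy; split=> //; rewrite conjgE invgK mulgA -ex mulgK.
Qed.

Lemma mark_bbas_self (K : {group gT}) (f : {morphism K >-> hT}) :
  K \subset G -> (f @* K)%g \subset H -> mark K f id (bbas p G H f) != 0.
Proof.
move=> sKG sfH; rewrite mark_bcls zloc_natr_eq0 -lt0n; apply/card_gt0P.
exists (quo_pi (trans_equiv G H f) (1%g, 1%g)); apply/fixptsP=> u Ku.
have uG := subsetP sKG u Ku.
have fuH : f u \in H by rewrite (subsetP sfH) ?mem_morphim.
split=> //.
have -> : lact (btrans G H f) (f u) (quo_pi (trans_equiv G H f) (1%g, 1%g)) =
          quo_pi (trans_equiv G H f) ((subg H (f u) * 1)%g, 1%g).
  by apply: quo_lactE => //; exact: trans_l_subproof.
have -> : ract (btrans G H f) (quo_pi (trans_equiv G H f) (1%g, 1%g)) u =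
          quo_pi (trans_equiv G H f) (1%g, (1 * subg G u)%g).
  by apply: quo_ractE => //; exact: trans_r_subproof.
apply/(quo_piP (trans_equiv G H f))/exists_inP; exists u => //=.
by rewrite !subgK // !mulg1 !mul1g !eqxx.
Qed.

Lemma bbas_conj (K L : {group gT}) (f : {morphism K >-> hT}) (g : {morphism L >-> hT})
    (x : hT) (y : gT) : x \in H -> y \in G -> L \subset G -> (g @* L)%g \subset H ->
    (K :^ y)%g = L -> {in K, forall u, f u = (g (u ^ y) ^ x)%g} ->
  bbas p G H f = bbas p G H g.
Proof.
move=> xH yG sLG sgH KL fg; apply: bcls_iso.
pose x0 := quo_pi (trans_equiv G H g) (subg H x^-1, subg G y^-1).
have xVH : x^-1%g \in H by rewrite groupV.
have yVG : y^-1%g \in G by rewrite groupV.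
apply: (transitive_biset_iso (X := btrans G H g) (x0 := x0)) => [h k hH kG|].
  have -> : lact (btrans G H g) h x0 =
            quo_pi (trans_equiv G H g) ((subg H h * subg H x^-1)%g, subg G y^-1).
    by apply: quo_lactE => //; exact: trans_l_subproof.
  have -> : ract (btrans G H g) x0 k =
            quo_pi (trans_equiv G H g) (subg H x^-1, (subg G y^-1 * subg G k)%g).
    by apply: quo_ractE => //; exact: trans_r_subproof.
  split=> [/(quo_piP (trans_equiv G H g))/exists_inP[l Ll /= /andP[]]|[Kk hE]].
    rewrite !subgK // => /eqP eh /eqP ek.
    have kE : (k ^ y)%g = l by rewrite conjgE mulgA ek mulgKV.
    have Kk : k \in K by rewrite -(memJ_conjg K y k) KL kE.
    split=> //; rewrite fg // kE conjgE mulgA.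
    by apply: (mulIg x^-1%g); rewrite eh mulgK.
  rewrite {}hE in hH *; have kyL : (k ^ y)%g \in L by rewrite -KL memJ_conjg.
  apply/(quo_piP (trans_equiv G H g))/exists_inP; exists (k ^ y)%g => //=.
  rewrite !subgK // fg //; apply/andP; split; apply/eqP.
    by rewrite conjgE mulgA mulgK.
  by rewrite conjgE mulgA mulgK.
elim/quo_ind=> -[u v]; exists (val u * x)%g, (y * val v)%g.
rewrite !groupM ?subgP //; split=> //.
have -> : ract (btrans G H g) x0 (y * val v)%g =
            quo_pi (trans_equiv G H g) (subg H x^-1, (subg G y^-1 * subg G (y * val v))%g).
  by apply: quo_ractE; rewrite ?groupM ?subgP //; exact: trans_r_subproof.
rewrite [RHS](_ : _ = quo_pi (trans_equiv G H g) ((subg H (val u * x) * subg H x^-1)%g, (subg G y^-1 * subg G (y * val v))%g)); last first.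
  by apply: quo_lactE; rewrite ?groupM ?subgP //; exact: trans_l_subproof.
congr (quo_pi _ _); congr (_, _); apply: val_inj; rewrite /= !subgK ?groupM ?subgP //.
  by rewrite mulgK.
by rewrite mulKg.
Qed.

(** Triangularity of the table of marks: at a graph (K, f) of the sum with |K|
maximal, only the conjugates of this graph have a nonzero mark, so their
coefficients add up to zero and they can be removed. *)
Lemma bgraph_sum_eq0 n (c : 'I_n -> zloc p) (e : 'I_n -> graph_index G H)
    (J : {set 'I_n}) :
    {in J, forall i, mark (tag (e i)) (sval (tagged (e i))) id (\sum_(j in J) c j *: bgraph p (e j)) = 0} ->
  \sum_(j in J) c j *: bgraph p (e j) = 0.
Proof.
have [k] := ubnP #|J|; elim: k => // k IHk in J *; rewrite ltnS => leJk mJ.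
have [->|[i1 Ji1]] := set_0Vmem J; first by rewrite big_set0.
pose sz i := #|tag (e i)|.
have [i0 Ji0 max_i0] := @arg_maxnP _ i1 (mem J) sz Ji1.
pose J0 := [set i in J | bgraph p (e i) == bgraph p (e i0)].
have sub0 i : i \in J ->
    mark (tag (e i0)) (sval (tagged (e i0))) id (bgraph p (e i)) != 0 -> i \in J0.
  move=> Ji; rewrite inE Ji /= /bgraph.
  have [sK sf] := svalP (tagged (e i0)); have [sL sg] := svalP (tagged (e i)).
  case/mark_bbas_neq0=> x [y [xH yG xy]]; apply/eqP/esym.
  apply: (bbas_conj xH yG sL sg) => [|u Ku]; last by have [] := xy u Ku.
  apply/eqP; rewrite eqEcard cardJg; apply/andP; split; last exact: (max_i0 i Ji).
  by apply/subsetP=> _ /imsetP[u Ku ->]; have [] := xy u Ku.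
have sumJ : \sum_(j in J0) c j = 0.
  have := mJ i0 Ji0; rewrite /= mark_sum (big_setID J0) /=.
  rewrite [X in _ + X]big1 ?addr0 => [|i /setDP[Ji J0i]]; last first.
    apply/eqP; rewrite zloc_mulf_eq0 orbC; apply/orP; left.
    by apply: contraR J0i; apply: sub0.
  have sJ0 : J :&: J0 = J0 by apply/setIidPr/subsetP=> i /setIdP[].
  rewrite sJ0 (eq_bigr (fun i => c i * mark (tag (e i0)) (sval (tagged (e i0))) id (bgraph p (e i0)))); last first.
    by move=> i /setIdP[_ /eqP->].
  have [sK sf] := svalP (tagged (e i0)).
  rewrite -mulr_suml => /eqP; rewrite zloc_mulf_eq0 (negPf (mark_bbas_self sK sf)) orbF.
  by move/eqP.
have zero : \sum_(j in J0) c j *: bgraph p (e j) = 0.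
  rewrite (eq_bigr (fun i => c i *: bgraph p (e i0))); last by move=> i /setIdP[_ /eqP->].
  by rewrite -scaler_suml sumJ scale0r.
have sJ0 : J :&: J0 = J0 by apply/setIidPr/subsetP=> i /setIdP[].
have sumD : \sum_(j in J) c j *: bgraph p (e j) = \sum_(j in J :\: J0) c j *: bgraph p (e j).
  by rewrite (big_setID J0) /= sJ0 zero add0r.
rewrite sumD; apply: IHk => [|i /setDP[Ji _]]; last by rewrite -sumD; apply: mJ.
apply: leq_trans leJk; apply: proper_card; apply/properP; split; first exact: subsetDl.
by exists i0; rewrite // !inE eqxx andbT; apply/nandP; left; rewrite negbK; apply: Ji0.
Qed.

(** Terms of the expansion inside the family B have no mark outside B, hence the
remaining terms satisfy the hypothesis of bgraph_sum_eq0. *)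
Lemma span_of_marks (B : forall K : {group gT}, {morphism K >-> hT} -> Prop)
    (a : burnside p G H) :
    (forall (K L : {group gT}) (f : {morphism K >-> hT}) (g : {morphism L >-> hT}),
       K \subset G -> (f @* K)%g \subset H -> L \subset G -> (g @* L)%g \subset H ->
       B L g -> mark K f id (bbas p G H g) != 0 -> B K f) ->
    (forall (K : {group gT}) (f : {morphism K >-> hT}),
       K \subset G -> (f @* K)%g \subset H -> ~ B K f -> mark K f id a = 0) ->
  in_span (fun b => exists (K : {group gT}) (f : {morphism K >-> hT}),
             B K f /\ b = bbas p G H f) a.
Proof.
move=> Bcl Ba; have [n [c [e aE]]] := graph_expansion a.
pose J := [set i | ~~ `[< B _ (sval (tagged (e i))) >]].
have JP i : reflect (~ B _ (sval (tagged (e i)))) (i \in J).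
  by rewrite inE; apply: asboolPn.
have a_split : a = \sum_(i in ~: J) c i *: bgraph p (e i) + \sum_(i in J) c i *: bgraph p (e i).
  by rewrite aE [LHS](bigID (fun i => i \in J)) /= addrC; congr (_ + _); apply: eq_bigl => i; rewrite in_setC.
rewrite a_split [X in _ + X]bgraph_sum_eq0 ?addr0 => [|i /JP nBi].
  elim/big_rec: _ => [|i v]; first exact: in_span0.
  rewrite inE => /JP/contrapT Bi; apply: in_spanD; apply/in_spanZ/in_span_gen.
  by exists (tag (e i)), (sval (tagged (e i))).
have [sK sf] := svalP (tagged (e i)).
have := Ba _ _ sK sf nBi; rewrite {1}a_split markD mark_sum big1 ?add0r // => j.
rewrite inE => /JP/contrapT Bj; apply/eqP; rewrite zloc_mulf_eq0 orbC; apply/orP; left.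
apply: contra_notT nBi; have [sL sg] := svalP (tagged (e j)).
exact: Bcl.
Qed.

(** This is the case of the empty family B. *)
Lemma mark_inj (a b : burnside p G H) :
    (forall (K : {group gT}) (f : {morphism K >-> hT}),
       K \subset G -> (f @* K)%g \subset H -> mark K f id a = mark K f id b) ->
  a = b.
Proof.
move=> ab; apply: subr0_eq.
have [K f|K f sKG sfH _|s Bs ->] := @span_of_marks (fun _ _ => False) (a - b).
- by [].
- by rewrite -scaleN1r addrC mark_lin mulN1r ab // addNr.
by rewrite big_seq big1 // => i /Bs[K [f []]].
Qed.
End MarkSpan.

(** * The extension congruence *)
Section Homs.
Variables (kT hT : finGroupType) (T : {group kT}) (H : {set hT}).

(** Homomorphisms are represented by finite functions, to be summed over; the
value 1 outside T makes the representation unique. *)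
Definition homs : {set {ffun kT -> hT}} :=
  [set r : {ffun kT -> hT} | [&& [forall u in T, r u \in H],
               [forall u in T, forall v in T, r (u * v)%g == (r u * r v)%g] &
               [forall u, (u \in T) || (r u == 1%g)]]].

Lemma homsP (r : {ffun kT -> hT}) :
  reflect [/\ {in T, forall u, r u \in H}, {in T &, {morph r : u v / (u * v)%g}} &
              forall u, u \notin T -> r u = 1%g]
          (r \in homs).
Proof.
rewrite inE; apply: (iffP and3P) => -[rH rM r1]; split.
- exact/forall_inP.
- by move=> u v Tu Tv; apply/eqP; move/forall_inP: rM => /(_ u Tu)/forall_inP; apply.
- by move=> u Tu; have /orP[|/eqP] := forallP r1 u; rewrite ?(negPf Tu).
- exact/forall_inP.
- by apply/forall_inP=> u Tu; apply/forall_inP=> v Tv; rewrite rM.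
- by apply/forallP=> u; case: (boolP (u \in T)) => //= /r1->.
Qed.

Definition hrestr (f : kT -> hT) : {ffun kT -> hT} :=
  [ffun u => if u \in T then f u else 1%g].

Lemma hrestrE f : {in T, hrestr f =1 f}.
Proof. by move=> u Tu; rewrite ffunE Tu. Qed.

Lemma hrestr_homs (f : kT -> hT) :
  {in T, forall u, f u \in H} -> {in T &, {morph f : u v / (u * v)%g}} ->
  hrestr f \in homs.
Proof.
move=> fH fM; apply/homsP; split=> [u Tu|u v Tu Tv|u Tu].
- by rewrite hrestrE ?fH.
- by rewrite !hrestrE ?groupM ?fM.
- by rewrite ffunE (negPf Tu).
Qed.

Lemma homs_inj : {in homs &, forall r s : {ffun kT -> hT}, {in T, r =1 s} -> r = s}.
Proof.
move=> r s /homsP[_ _ r1] /homsP[_ _ s1] rs; apply/ffunP=> u.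
by case: (boolP (u \in T)) => [/rs|uT] //; rewrite r1 ?s1.
Qed.
End Homs.

Section LeftOrbits.
Variables (gT hT : finGroupType) (G : {group gT}) (H : {group hT}).
Variable X : biset G H.
Implicit Types x y : X.

Lemma lorbitP x y : reflect (exists2 h, h \in H & y = lact X h x) (y \in lorbit x).
Proof. exact: imsetP. Qed.

Lemma lorbit_eqP x y :
  reflect (exists2 h, h \in H & y = lact X h x) (lorbit y == lorbit x).
Proof.
apply: (iffP eqP) => [e|[h hH ->]].
  by apply/lorbitP; rewrite -e; apply/lorbitP; exists 1%g; rewrite ?group1 ?lact1.
apply/setP=> z; apply/lorbitP/lorbitP=> -[k kH ->].
  by exists (k * h)%g; rewrite ?groupM ?lactM.
by exists (k * h^-1)%g; rewrite ?groupM ?groupV // lactM ?groupV // lactK.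
Qed.

Lemma lact_inj x : {in H &, injective (lact X ^~ x)}.
Proof.
move=> h k hH kH /= e; apply/eqP; rewrite eq_sym eq_mulVg1; apply/eqP.
apply: (@lact_free _ _ _ _ X _ _ x); first by rewrite groupM ?groupV.
by rewrite lactM ?groupV // e lactK.
Qed.

Lemma card_biset : #|X| = (#|H| * norbits X)%N.
Proof.
have -> : norbits X = #|[set lorbit x | x in [set: X]]|.
  by rewrite /norbits; apply: eq_card => D; apply/imsetP/imsetP=> -[x _ ->]; exists x.
rewrite -cardsT -sum1_card (partition_big_imset (@lorbit _ _ _ _ X)) /= mulnC.
rewrite -sum_nat_const; apply: eq_bigr => _ /imsetP[x _ ->]; rewrite sum1dep_card.
rewrite -(card_in_imset (@lact_inj x)); apply: eq_card => y.
by rewrite inE in_setT; apply/lorbit_eqP/lorbitP.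
Qed.
End LeftOrbits.

Section ExtensionCount.
Variables (p : nat) (gT hT kT : finGroupType) (G : {group gT}) (H : {group hT}).
Variables (X : biset G H) (Q T : {group kT}) (a : kT -> hT) (b : kT -> gT).
Hypotheses (pT : (p.-group T)%g) (nQT : (Q <| T)%g).
Hypotheses (bG : {in T, forall u, b u \in G})
           (bM : {in T &, {morph b : u v / (u * v)%g}}).
Hypothesis (a_stable : {in T, forall t, exists2 h, h \in H &
                          {in Q, forall u, a (u ^ t)%g = (a u ^ h)%g}}).

Let sQT : {subset Q <= T}. Proof. exact/subsetP/normal_sub. Qed.

(** A partial action has to be injective at every group element, hence the
identity outside T. *)
Definition translate (x : X) (t : kT) : X := if t \in T then ract X x (b t) else x.

Fact translate_action : is_action T translate.
Proof.
split=> [t x y|x t s Tt Ts]; rewrite /translate; last first.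
  by rewrite Tt Ts groupM // bM // ractM ?bG.
case: ifP => // Tt e.
by rewrite -(ractK x (bG Tt)) e ractK ?bG.
Qed.

Definition translation : action T X := Action translate_action.

Let translationE x t : t \in T -> translation x t = ract X x (b t).
Proof. by move=> Tt; rewrite /= /translate Tt. Qed.

Let A := fixpts Q a b X.
Let C := 'C_H(a @: Q)%g.
Let B := [set x in A | [forall t in T, b t \in stab_set x]].

(** Inside the fixed points A of (a, b), the H-orbits are the orbits of the
centralizer of a(Q), which acts freely. *)
Let card_lorbit (D : {set X}) :
    D \subset A -> {in D & A, forall x y, lorbit y = lorbit x -> y \in D} ->
  #|D| = (#|C| * #|[set lorbit x | x in D]|)%N.
Proof.
move=> sDA Dcl; rewrite -sum1_card (partition_big_imset (@lorbit _ _ _ _ X)) /=.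
rewrite mulnC -sum_nat_const; apply: eq_bigr => _ /imsetP[x Dx ->].
rewrite sum1dep_card; have Ax := subsetP sDA x Dx.
rewrite -(card_in_imset (f := fun h => lact X h x)); last first.
  by move=> h k /setIP[hH _] /setIP[kH _]; apply: lact_inj.
apply: eq_card => y; rewrite inE; apply/andP/imsetP=> [[Dy /lorbit_eqP[h hH e]]|[h /setIP[hH]]].
  exists h => //; rewrite inE hH; apply/centP=> _ /imsetP[u Qu ->].
  have /fixptsP Ay := subsetP sDA y Dy; move/fixptsP: (Ax) => {}Ax.
  have [aH bu ex] := Ax u Qu; have [_ _ ey] := Ay u Qu.
  move: ey; rewrite e lractA // -ex -!lactM // => ey.
  by apply: (lact_inj (x := x)); rewrite ?groupM.
move=> hC ->; have e : lorbit (lact X h x) = lorbit x by apply/eqP/lorbit_eqP; exists h.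
rewrite e; split=> //; apply: Dcl Dx _ e.
apply/fixptsP=> u Qu; have [aH bu ex] := elimT (fixptsP _ _ _ _) Ax u Qu; split=> //.
by rewrite lractA // -ex -!lactM // (centP hC) ?imset_f.
Qed.

Let translate_lorbit x t : t \in T -> (translation^*)%act (lorbit x) t = lorbit (ract X x (b t)).
Proof.
move=> Tt; apply/setP=> y; apply/imsetP/lorbitP.
  by case=> _ /lorbitP[h hH ->] ->; exists h; rewrite // translationE // lractA ?bG.
case=> h hH ->; exists (lact X h x); first by apply/lorbitP; exists h.
by rewrite translationE // lractA ?bG.
Qed.

(** Translation by b(t) turns a into a conjugate of a; correcting by the
conjugating element h comes back to A. Hence T acts on the H-orbits that
meet A. *)
Let A_translate x t : x \in A -> t \in T -> exists2 h, h \in H & lact X h^-1%g (ract X x (b t)) \in A.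
Proof.
move=> /fixptsP Ax Tt; have [h hH ah] := a_stable Tt; exists h => //.
apply/fixptsP=> u Qu.
have Qv : (u ^ t^-1)%g \in Q by rewrite memJ_norm ?groupV //; apply: (subsetP (normal_norm nQT)).
have [aH bu ex] := Ax _ Qv.
have au : a u = (a (u ^ t^-1) ^ h)%g by rewrite -ah // -conjgM mulVg conjg1.
have bu' : b u \in G by rewrite bG ?sQT.
have but : (b t * b u)%g = (b (u ^ t^-1) * b t)%g.
  have [Tv Tu] := (sQT Qv, sQT Qu).
  by rewrite -(bM Tt Tu) -(bM Tv Tt) conjgE invgK !mulgA mulgKV.
rewrite au groupJ //; split=> //.
rewrite conjgE !lactM ?groupM ?groupV // lactKV //.
rewrite lractA ?groupV //; congr lact.
rewrite -(ractM (bG Tt) bu' x) but (ractM bu (bG Tt) x) -ex.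
by rewrite lractA ?bG.
Qed.

Let B_lorbit x : x \in A -> (x \in B) = (lorbit x \in 'Fix_(translation^*)(T)%g).
Proof.
move=> Ax; rewrite inE Ax /=; apply/forall_inP/afixP=> fx t Tt.
  rewrite translate_lorbit //; apply/eqP/lorbit_eqP.
  by have [_ sH <-] := stab_funE (fx t Tt); exists (stab_fun x (b t)).
have /eqP := fx t Tt; rewrite translate_lorbit // => /lorbit_eqP[h hH e].
by apply: (@stab_setP _ _ _ _ _ _ _ h); rewrite ?bG.
Qed.

Let lorbits_B : [set lorbit x | x in B] = 'Fix_([set lorbit x | x in A] | translation^*)(T)%g.
Proof.
apply/setP=> D; apply/imsetP/setIP=> [[x Bx ->]|[/imsetP[x Ax ->]]].
  by have Ax : x \in A by [case/setIdP: Bx]; rewrite imset_f // -B_lorbit.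
by rewrite -B_lorbit // => Bx; exists x.
Qed.

Let acts_lorbits : [acts T, on [set lorbit x | x in A] | translation^*]%g.
Proof.
apply/subsetP=> t Tt; rewrite inE Tt inE; apply/subsetP=> _ /imsetP[x Ax ->].
rewrite inE translate_lorbit //; have [h hH Ahx] := A_translate Ax Tt.
apply/imsetP; exists (lact X h^-1%g (ract X x (b t))) => //.
by apply/esym/eqP/lorbit_eqP; exists h^-1%g; rewrite ?groupV.
Qed.

(** If T preserves the H-orbit of x, then x b(t) = r(t) x for exactly one
function r, which is a homomorphism. *)
Let sum_extensions :
  (\sum_(r in homs T H | [forall u in Q, r u == a u]) #|fixpts T r b X| = #|B|)%N.
Proof.
under eq_bigr do rewrite -sum1_card big_mkcond /=.
rewrite exchange_big /= -sum1_card [RHS]big_mkcond; apply: eq_bigr => x _.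
have [Bx|nBx] := ifPn.
  have [Ax /forall_inP sx] := setIdP Bx.
  pose r0 := hrestr T (fun t => stab_fun x (b t)).
  have r0P : r0 \in homs T H.
    apply: hrestr_homs => [t /sx/stab_funE[]//|t s Tt Ts].
    by rewrite bM //; apply: stab_morph; rewrite ?sx.
  have r0a : [forall u in Q, r0 u == a u].
    apply/forall_inP=> u Qu; rewrite hrestrE ?sQT //; apply/eqP/esym/stab_funP.
      by have [] := elimT (fixptsP _ _ _ _) Ax u Qu.
    by have [] := elimT (fixptsP _ _ _ _) Ax u Qu.
  have r0x : x \in fixpts T r0 b X.
    apply/fixptsP=> t Tt; rewrite hrestrE //.
    by have [? ? ->] := stab_funE (sx t Tt).
  rewrite (bigD1 r0) /= ?r0P ?r0a // r0x big1 ?addn0 // => r /andP[/andP[rP _] rr0].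
  case: ifP => // /fixptsP rx; case/eqP: rr0.
  apply: homs_inj rP r0P _ => t Tt; rewrite hrestrE //.
  by have [? ? ?] := rx t Tt; apply: stab_funP.
rewrite big1 // => r /andP[rP /forall_inP ra]; case: ifP => // /fixptsP rx.
case/negP: nBx; rewrite inE; apply/andP; split.
  by apply/fixptsP=> u Qu; rewrite -(eqP (ra u Qu)); apply/rx/sQT.
by apply/forall_inP=> t Tt; have [rH bt e] := rx t Tt; apply: stab_setP e.
Qed.

(** The p-group T acts on the H-orbits that meet A; its fixed points are those
that meet B. *)
Lemma extension_count : prime p ->
  exists m, [/\ #|fixpts Q a b X| =
                 (#|'C_H(a @: Q)%g| * #|[set lorbit x | x in fixpts Q a b X]|)%N,
    (\sum_(r in homs T H | [forall u in Q, r u == a u]) #|fixpts T r b X| =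
       #|'C_H(a @: Q)%g| * m)%N &
    #|[set lorbit x | x in fixpts Q a b X]| = m %[mod p]].
Proof.
move=> p_pr; exists #|[set lorbit x | x in B]|; split.
- by apply: card_lorbit => // x y _ Ay _; apply: Ay.
- rewrite sum_extensions; apply: card_lorbit => [|x y Bx Ay e].
    by apply/subsetP=> x /setIdP[].
  have Ax : x \in A by case/setIdP: Bx.
  by rewrite B_lorbit // e -B_lorbit.
- by rewrite lorbits_B; apply: pgroup_fix_mod.
Qed.
End ExtensionCount.

Section MarkExtension.
Variables (p : nat) (gT hT kT : finGroupType) (G : {group gT}) (H : {group hT}).
Hypothesis p_pr : prime p.

(** Extension congruence: a T-stable homomorphism a on Q has the same mark,
relative to the order of the centralizer of its image and modulo p, as all its
extensions to T together. *)
Lemma mark_extension (Q T : {group kT}) (a : kT -> hT) (b : kT -> gT)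
    (x : burnside p G H) :
    (p.-group T)%g -> (Q <| T)%g ->
    {in T, forall u, b u \in G} -> {in T &, {morph b : u v / (u * v)%g}} ->
    {in T, forall t, exists2 h, h \in H &
       {in Q, forall u, a (u ^ t)%g = (a u ^ h)%g}} ->
  exists k m, [/\ mark Q a b x = #|'C_H(a @: Q)%g|%:R * k,
    \sum_(r in homs T H | [forall u in Q, r u == a u]) mark T r b x =
      #|'C_H(a @: Q)%g|%:R * m & zloc_pdvd (k - m)].
Proof.
move=> pT nQT bG bM ast; elim/burnside_ind: x => [X||c u v IHu IHv].
- have [m [eX eS em]] := extension_count X pT nQT bG bM ast p_pr.
  exists #|[set lorbit x | x in fixpts Q a b X]|%:R, m%:R; split.
  + by rewrite mark_bcls eX natrM.
  + rewrite -natrM -eS natr_sum; apply: eq_bigr => r _; exact: mark_bcls.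
  + exact: pdvd_natr_mod.
- exists 0, 0; rewrite mark0 mulr0 subrr; split=> //; last exact: pdvd0.
  by rewrite big1 // => r _; rewrite mark0.
have [k [m [eu su du]]] := IHu; have [k' [m' [ev sv dv]]] := IHv.
exists (c * k + k'), (c * m + m'); split.
- by rewrite mark_lin eu ev mulrDr mulrCA.
- under eq_bigr do rewrite mark_lin.
  by rewrite big_split -mulr_sumr /= su sv mulrDr mulrCA.
- by rewrite opprD addrACA -mulrBr; apply: pdvdD dv; apply: pdvd_mull.
Qed.

Lemma cent_trivial_image (Q : {set kT}) : 'C_H((fun _ : kT => 1%g : hT) @: Q)%g = H.
Proof.
apply/setIidPl/subsetP=> h _; apply/centP=> _ /imsetP[u _ ->].
exact: commute1.
Qed.

(** The case Q = 1, where the mark is |H| times the augmentation. *)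
Lemma mark_homs_sum (T : {group kT}) (b : kT -> gT) (x : burnside p G H) :
    (p.-group T)%g ->
    {in T, forall u, b u \in G} -> {in T &, {morph b : u v / (u * v)%g}} ->
  exists2 m, \sum_(r in homs T H) mark T r b x = #|H|%:R * m & zloc_pdvd (baug x - m).
Proof.
move=> pT bG bM.
have st : {in T, forall t : kT, exists2 h, h \in H &
            {in 1%G, forall u : kT, 1%g = (1 ^ h)%g :> hT}}.
  by move=> t _; exists 1%g; rewrite ?group1 // => u _; rewrite conj1g.
have b1 : b 1%g = 1%g.
  by apply: (mulgI (b 1%g)); rewrite mulg1 -bM ?mulg1 ?group1.
have [k [m [e1 e2 km]]] := mark_extension x pT (normal1 T) bG bM st.
rewrite !cent_trivial_image in e1 e2; exists m.
  rewrite -e2; apply: eq_bigl => r; have [rT|] //= := boolP (r \in homs T H).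
  apply/esym/forall_inP=> _ /set1P->; have [_ rM _] := homsP _ _ _ rT.
  by apply/eqP; apply: (mulgI (r 1%g)); rewrite mulg1 -rM ?mulg1 ?group1.
suff <- : k = baug x by [].
apply: (@zloc_mulfI p #|H|%:R); first by rewrite zloc_natr_eq0 -lt0n cardG_gt0.
rewrite -e1; elim/burnside_ind: x {e1 e2} => [X||c u v IHu IHv].
- rewrite mark_bcls baug_bcls -natrM -card_biset; congr _%:R.
  rewrite -cardsT; apply: eq_card => x; rewrite in_setT; apply/fixptsP=> _ /set1P->.
  by rewrite b1 !group1 lact1 ract1.
- have := baug_linear (-1) (0 : burnside p G H) 0.
  by rewrite scaler0 addr0 scaleN1r addNr mark0 => ->; rewrite mulr0.
- by rewrite mark_lin IHu IHv baug_linear mulrDr mulrCA.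
Qed.
End MarkExtension.

(** Inverting both actions exchanges the sides of a bifree biset; this is how
bifreeness gives a congruence for sums over the second argument of marks. *)
Section Opposite.
Variables (gT hT : finGroupType) (G : {group gT}) (H : {group hT}).
Variables (X : biset G H) (freeX : bifree X).

Fact bop_subproof : biset_axioms H G (fun g x => ract X x g^-1%g) (fun x h => lact X h^-1%g x).
Proof.
split=> [x|g k gG kG x|x|h k hH kH x|g h gG hH x|g gG x e].
- by rewrite invg1 ract1.
- by rewrite invMg ractM ?groupV.
- by rewrite invg1 lact1.
- by rewrite invMg lactM ?groupV.
- by rewrite lractA ?groupV.
- by apply/eqP; rewrite -eq_invg1; apply/eqP; apply: freeX e; rewrite groupV.
Qed.

Definition bop : biset H G := Biset (BisetOn bop_subproof).

Lemma card_fixpts_bop (kT : finGroupType) (K : {set kT}) (a : kT -> hT) (b : kT -> gT) :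
  #|fixpts K b a bop| = #|fixpts K a b X|.
Proof.
apply: eq_card => x; apply/fixptsP/fixptsP=> fx u Ku; have [? ? /= e] := fx u Ku; split=> //=.
  by rewrite -{1}(ractKV x (g := b u)) // e lractA ?groupV // lactKV.
by rewrite -{1}(lactK x (h := a u)) // e lractA ?groupV // ractK.
Qed.
End Opposite.

(** The augmentation is the same on both sides, because the two acting groups
have the same order. *)
Lemma mark_homs_sum_op p (gT kT : finGroupType) (S : {group gT}) (T : {group kT})
    (a : kT -> gT) (x : burnside p S S) :
    prime p -> (p.-group T)%g -> bifree_element x ->
    {in T, forall u, a u \in S} -> {in T &, {morph a : u v / (u * v)%g}} ->
  exists2 m, \sum_(r in homs T S) mark T a r x = #|S|%:R * m & zloc_pdvd (baug x - m).
Proof.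
move=> p_pr pT xfree aS aM; elim/in_span_ind: xfree => [_ [Y [freeY ->]]||c u v [m su du] [m' sv dv]].
- have [m sm dm] := mark_homs_sum p_pr (bcls p (bop freeY)) pT aS aM.
  exists m; first by rewrite -sm; apply: eq_bigr => r _; rewrite !mark_bcls card_fixpts_bop.
  move: dm; rewrite !baug_bcls; suff -> : norbits (bop freeY) = norbits Y by [].
  apply/eqP; rewrite -(eqn_pmul2l (cardG_gt0 S)).
  by rewrite -card_biset -(card_biset Y).
- exists 0; first by rewrite mulr0 big1 // => r _; rewrite mark0.
  have := baug_linear (-1) (0 : burnside p S S) 0.
  by rewrite scaler0 addr0 scaleN1r addNr => ->; rewrite subrr; apply: pdvd0.
exists (c * m + m').
  under eq_bigr do rewrite mark_lin.
  by rewrite big_split -mulr_sumr /= su sv mulrDr mulrCA.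
by rewrite baug_linear opprD addrACA -mulrBr; apply: pdvdD dv; apply: pdvd_mull.
Qed.

(** * Weighted counting of homomorphisms *)
Section OrbitSum.
Variables (p : nat) (gT : finGroupType) (S P : {group gT}) (D : {group {perm gT}}).
Hypotheses (pD : (p.-group D)%g) (sDP : D \subset Aut P).

(** S acts on Hom(P, S) by conjugation after a homomorphism, D by automorphisms
before it. *)
Definition hact (r : {ffun gT -> gT}) (e : gT * {perm gT}) : {ffun gT -> gT} :=
  [ffun u => (r (e.2^-1%g u) ^ e.1)%g].

Fact hact_is_action : is_action [set: gT * {perm gT}] hact.
Proof.
split=> [[s d] r r' e|r [s d] [s' d'] _ _].
  apply/ffunP=> u; move/ffunP/(_ (d u)): e; rewrite !ffunE /= permK.
  exact: conjg_inj.
by apply/ffunP=> u; rewrite !ffunE /= conjgM invMg permM.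
Qed.

Definition hom_action : {action (gT * {perm gT}) &-> {ffun gT -> gT}} :=
  Action hact_is_action.

Let E := setX_group S D.

Let hactE r s d u : hom_action r (s, d) u = (r (d^-1%g u) ^ s)%g.
Proof. by rewrite /= ffunE. Qed.

Let D_P d u : d \in D -> (d u \in P) = (u \in P).
Proof. by move=> /(subsetP sDP)/setIdP[/perm_closed-> _]. Qed.

Let D_M d : d \in D -> {in P &, {morph d : u v / (u * v)%g}}.
Proof. by move=> /(subsetP sDP)/setIdP[_ /morphicP]. Qed.

Lemma acts_homs : [acts E, on homs P S | hom_action]%g.
Proof.
apply/actsP=> -[s d] /setXP[/= sS dD] r.
have hom_cl r' e : e \in E -> r' \in homs P S -> hom_action r' e \in homs P S.
  case: e => s' d' /setXP[/= s'S d'D] /homsP[rS rM r1].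
  have dVD : (d'^-1)%g \in D by rewrite groupV.
  apply/homsP; split=> [u Pu|u v Pu Pv|u nPu].
  - by rewrite hactE groupJ ?rS ?D_P.
  - by rewrite !hactE D_M // rM ?D_P // conjMg.
  - by rewrite hactE r1 ?D_P // conj1g.
apply/idP/idP; last by apply: hom_cl; apply/setXP.
move=> h; rewrite -(actK hom_action (s, d) r).
by apply: hom_cl h; rewrite groupV; apply/setXP.
Qed.

(** The stabilizer of r in S x D projects to D with kernel C_S(r(P)); the index
j of its image is a power of p, equal to 1 exactly when each d in D is
realized by an element of S. *)
Let orbit_centraliser (r : {ffun gT -> gT}) : r \in homs P S ->
  exists2 j, (#|orbit hom_action E r| * #|'C_S(r @: P)%g| = #|S| * j)%N &
    (p %| j)%N \/ {in D, forall d : {perm gT}, exists2 s, s \in S &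
                     {in P, forall u, r (d u) = (r u ^ s)%g}}.
Proof.
move=> rP; have [rS rM r1] := homsP _ _ _ rP.
pose St := ('C_E[r | hom_action])%G.
have StP s d : reflect [/\ s \in S, d \in D & {in P, forall u, r (d u) = (r u ^ s)%g}]
                       ((s, d) \in St).
  apply: (iffP setIP) => [[/setXP[/= sS dD] /astab1P e]|[sS dD e]].
    by split=> // u Pu; rewrite -{1}e hactE permK.
  split; first exact/setXP.
  apply/astab1P/ffunP=> u; rewrite hactE; have [Pu|nPu] := boolP (u \in P).
    by rewrite -e ?D_P ?groupV // permKV.
  by rewrite !r1 ?conj1g // D_P ?groupV.
pose K := 'C_S(r @: P)%g.
pose f := snd_morphism gT {perm gT}.
have fSt : (f @* St)%g \subset D.
  by apply/subsetP=> _ /morphimP[[s d] _ /StP[_ dD _] ->].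
have cK : #|(St :&: 'ker f)%g| = #|K|.
  rewrite -[#|K|]muln1 -(cards1 (1%g : {perm gT})) -cardsX; apply: eq_card => -[s d].
  have kerP : ((s, d) \in 'ker f)%g = (d == 1%g) by rewrite !inE.
  rewrite in_setI kerP in_setX in_set1 /=.
  apply/andP/andP=> [[/StP[sS _ e] /eqP d1]|[/setIP[sS cs] /eqP->]].
    split; last exact/eqP.
    rewrite inE sS; apply/centP=> _ /imsetP[u Pu ->].
    by apply/commute_sym/commgP/conjg_fixP; rewrite -e ?d1 ?perm1.
  split=> //; apply/StP; split=> // u Pu; rewrite perm1.
  by apply/esym/conjg_fixP/commgP/commute_sym/(centP cs)/imset_f.
have := card_orbit_stab hom_action E r.
rewrite -[#|'C_E[_ | _]%g|](LagrangeI St ('ker f)) cK.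
have -> : #|St : 'ker f|%g = #|(f @* St)%g| by rewrite card_morphim setTI.
rewrite cardsX -(Lagrange fSt) mulnA [(#|f @* St|%g * _)%N]mulnC mulnA => /eqP.
rewrite eqn_pmul2r ?cardG_gt0 // => /eqP cO; exists #|D : f @* St|%g => //.
have [/eqP|jn1] := eqVneq #|D : f @* St|%g 1%N.
  rewrite indexg_eq1 => sDf; right=> d dD.
  have /morphimP[[s d'] _ /StP[sS _ e] dd'] := subsetP sDf d dD.
  by exists s => //; rewrite dd'.
left; have : (p.-nat #|D : f @* St|%g)%N by apply: pnat_dvd (dvdn_indexg _ _) pD.
by case/p_natP=> // -[|k] jE; rewrite jE ?eqxx // in jn1 *; rewrite expnS dvdn_mulr.
Qed.

(** The orbit of r contributes |S| j k(r) to the sum, j being the index in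
orbit_centraliser. If no r had j = 1 and k(r) prime to p, the sum would be a
multiple of p |S|. *)
Lemma exists_unit_orbit (w k : {ffun gT -> gT} -> zloc p) (e : zloc p) :
    {in homs P S, forall r : {ffun gT -> gT}, w r = #|'C_S(r @: P)%g|%:R * k r} ->
    {in homs P S & E, forall r x, w (hom_action r x) = w r} ->
    \sum_(r in homs P S) w r = #|S|%:R * e -> ~ zloc_pdvd e ->
  exists2 r : {ffun gT -> gT}, r \in homs P S & ~ zloc_pdvd (k r) /\
    {in D, forall d : {perm gT}, exists2 s, s \in S &
       {in P, forall u, r (d u) = (r u ^ s)%g}}.
Proof.
move=> wk wE sw ne; apply: contrapT => none; apply: ne.
have S0 : #|S|%:R != 0 :> zloc p by rewrite zloc_natr_eq0 -lt0n cardG_gt0.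
suff [z sz] : exists z, \sum_(r in homs P S) w r = #|S|%:R * (p%:R * z).
  by exists z; apply: (zloc_mulfI S0); rewrite -sw.
rewrite (set_partition_big _ (orbit_partition acts_homs)) /=.
elim/big_rec: _ => [|O v]; first by exists 0; rewrite !mulr0.
case/imsetP=> r rP -> [z ->].
have -> : \sum_(x in orbit hom_action E r) w x = #|orbit hom_action E r|%:R * w r.
  by rewrite -sum1_card natr_sum mulr_suml; apply: eq_bigr => _ /imsetP[x Ex ->]; rewrite mul1r wE.
rewrite wk // mulrA -natrM; have [j -> jP] := orbit_centraliser rP.
suff [y yE] : exists y, j%:R * k r = p%:R * y.
  by exists (y + z); rewrite natrM -mulrA yE !mulrDr.
have [pk|npk] := pselect (zloc_pdvd (k r)).
  by case: pk => y ->; exists (j%:R * y); rewrite mulrCA.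
case: jP => [/dvdnP[i ->]|st]; last by case: none; exists r.
by exists (i%:R * k r); rewrite natrM mulrA [p%:R * _]mulrC.
Qed.
End OrbitSum.

(** * Right characteristic elements satisfy Frobenius reciprocity *)
Section FusionSystems.
Variables (p : nat) (gT : finGroupType) (S : {group gT}) (F : fusion_system S).

Lemma fconj_im (P Q : {group gT}) (f : {morphism P >-> gT}) :
  fhom F Q f -> fconj F P (f @* P)%G.
Proof.
move=> Ff; have [_ _ _ injf] := fhom_obj Ff.
exists f, (invm_morphism injf); split; first exact: fhom_onto Ff.
- by apply: fhom_inv Ff _ => u Pu; apply: invmE.
- by move=> u Pu; apply: invmE.
- by move=> v Qv; apply: invmK.
Qed.

(** By mark_bbas_neq0, f is g restricted between two conjugations by elements
of S. *)
Lemma fhom_subconj (K L : {group gT}) (f : {morphism K >-> gT}) (g : {morphism L >-> gT}) :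
    K \subset S -> (f @* K)%g \subset S -> fhom F S g ->
  mark K f id (bbas p S S g) != 0 -> fhom F S f.
Proof.
move=> sKS sfS Fg /mark_bbas_neq0[x [y [xS yS fg]]].
have [sLS _ sgS _] := fhom_obj Fg.
have Fc : fhom F L (conjgm_morphism K y).
  apply: (@fhom_conj _ _ F K L _ y^-1) => //; first by rewrite groupV.
    by move=> u Ku /=; rewrite conjgmE // conjgE invgK mulgA.
  by apply/subsetP=> _ /morphimP[u _ Ku ->] /=; rewrite conjgmE //; have [] := fg u Ku.
have gyM : {in K &, {morph (fun u => g (u ^ y)%g) : u v / (u * v)%g}}.
  by move=> u v Ku Kv; rewrite conjMg morphM //; [have [] := fg u Ku | have [] := fg v Kv].
pose gy : {morphism K >-> gT} := Morphism gyM.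
have Fgy : fhom F S gy.
  by apply: fhom_comp Fc Fg _ => u Ku /=; rewrite conjgmE.
have sgyS : (gy @* K)%g \subset S by have [] := fhom_obj Fgy.
apply: (@fhom_comp _ _ F _ _ _ gy (conjgm_morphism (gy @* K)%G x)); first exact: fhom_onto Fgy.
  apply: (@fhom_conj _ _ F _ _ _ x^-1) => //; first by rewrite groupV.
    by move=> u Ku /=; rewrite conjgmE // conjgE invgK mulgA.
  by apply/subsetP=> _ /morphimP[u _ Ku ->] /=; rewrite conjgmE // groupJ // (subsetP sgyS).
by move=> u Ku; have [] := fg u Ku.
Qed.

(** Marks reduce the claim to m(a, id) = m(a, b) for b with m(b, id) nonzero.
Such a b is a morphism of F, because X is F-generated, and right stability
concludes. *)
Lemma right_characteristic_frobenius (X : burnside p S S) :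
  fgenerated F X -> right_stable F X -> frobenius_reciprocity X.
Proof.
move=> gen stab; apply: mark_inj => K f sKS sfS.
have fS u : u \in K -> f u \in setX S S.
  by move=> Ku; apply: (subsetP sfS); rewrite mem_morphim.
pose a u := (f u).1; pose b u := (f u).2.
have bS : {in K, forall u, b u \in S} by move=> u /fS; rewrite inE => /andP[].
have fab : {in K, f =1 fun u => (a u, b u)} by move=> u _; apply: surjective_pairing.
have idK : {in K, @id gT =1 id} by [].
rewrite [LHS](eq_mark _ fab idK) [RHS](eq_mark _ fab idK).
rewrite mark_frobenius_l => [|u /(subsetP sKS) //]; rewrite mark_frobenius_r.
have [->|bid] := eqVneq (mark K b id X) 0; first by rewrite !mulr0.
congr (_ * _).
have bM : {in K &, {morph b : u v / (u * v)%g}} by move=> u v Ku Kv; rewrite /b morphM.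
pose bm : {morphism K >-> gT} := Morphism bM.
have sbS : (bm @* K)%g \subset S by apply/subsetP=> _ /morphimP[u _ Ku ->]; apply: bS.
have Fb : fhom F S bm.
  apply: contrapT => nF; case/eqP: bid; elim/in_span_ind: gen => [_ [L [g [Fg ->]]]||c u v eu ev].
  - by apply/eqP/negPn/negP=> e; apply: nF; exact: (@fhom_subconj K L bm g sKS sbS Fg e).
  - exact: mark0.
  - by rewrite mark_lin eu ev mulr0 addr0.
have KK : {in K, forall u, id u \in K} by [].
have siS : (idm_morphism K @* K)%g \subset S by rewrite /= morphim_idm.
have := congr1 (mark K a id) (stab K bm Fb).
rewrite (mark_bcomp_trans a X sbS KK) (mark_bcomp_trans a X siS KK) => e.
exact: esym e.
Qed.
End FusionSystems.

(** * The equivalence relation defined by a reciprocal element *)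
Lemma bifree_mark p (gT kT : finGroupType) (S : {group gT}) (K : {set kT})
    (a b : kT -> gT) (x : burnside p S S) (u : kT) :
  bifree_element x -> u \in K -> a u = 1%g -> b u <> 1%g -> mark K a b x = 0.
Proof.
move=> xfree Ku au bu; elim/in_span_ind: xfree => [_ [Y [freeY ->]]||c v w ev ew].
- rewrite mark_bcls; suff -> : fixpts K a b Y = set0 by rewrite cards0.
  apply/setP=> y; rewrite in_set0; apply/fixptsP=> fy.
  have [_ bS] := fy u Ku; rewrite au lact1 => e.
  by case: bu; apply: freeY (esym e).
- exact: mark0.
- by rewrite mark_lin ev ew mulr0 addr0.
Qed.

Section FrobeniusTheory.
Variables (p : nat) (gT : finGroupType) (S : {group gT}) (X : burnside p S S).
Hypotheses (p_pr : prime p) (pS : (p.-group S)%g).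
Hypotheses (X_bifree : bifree_element X) (X_aug : ~ zloc_pdvd (baug X)).
Hypothesis X_frob : forall (K : {set gT}) (a b c : gT -> gT),
  {in K, forall u, c u \in S} ->
  mark K a c X * mark K b c X = mark K a b X * mark K b c X.

Definition hom_on (P : {set gT}) (f : gT -> gT) : Prop :=
  {in P, forall u, f u \in S} /\ {in P &, {morph f : u v / (u * v)%g}}.

(** For injective a and b this will mean that b a^-1 : a(P) -> b(P) is an
isomorphism of the fusion system to be constructed. Locked for the same reason
as marks. *)
Definition sim (P : {set gT}) (a b : gT -> gT) : bool :=
  locked (fun (Q : {set gT}) (c d : gT -> gT) => mark Q c d X != 0) P a b.

Lemma simE P a b : sim P a b = (mark P a b X != 0).
Proof. by rewrite /sim -lock. Qed.

Lemma homs_hom_on (P : {group gT}) (r : {ffun gT -> gT}) : r \in homs P S -> hom_on P r.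
Proof. by case/homsP. Qed.

Lemma hom_on_sub (P Q : {set gT}) f : Q \subset P -> hom_on P f -> hom_on Q f.
Proof.
by move=> /subsetP sQP [fS fM]; split=> [u /sQP/fS //|u v /sQP Pu /sQP Pv]; apply: fM.
Qed.

Lemma hom_on_id (P : {set gT}) : P \subset S -> hom_on P id.
Proof. by move=> /subsetP sPS; split=> // u /sPS. Qed.

Lemma sum_neq0 (I : finType) (P : pred I) (F : I -> zloc p) :
  \sum_(i | P i) F i != 0 -> exists2 i, P i & F i != 0.
Proof.
move=> sn0; apply: contrapT => none; case/eqP: sn0; apply: big1 => i Pi.
by apply/eqP/negPn/negP=> Fi; case: none; exists i.
Qed.

Lemma pdvd_neq0 (x : zloc p) : ~ zloc_pdvd x -> x != 0.
Proof. by move=> nx; apply/eqP=> x0; apply: nx; rewrite x0; apply: pdvd0. Qed.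

Lemma cardG_zloc_neq0 (G : {group gT}) : #|G|%:R != 0 :> zloc p.
Proof. by rewrite zloc_natr_eq0 -lt0n cardG_gt0. Qed.

Lemma cent_zloc_neq0 (A : {set gT}) : #|'C_S(A)%g|%:R != 0 :> zloc p.
Proof. exact: cardG_zloc_neq0. Qed.

Lemma sub_pgroup (P : {group gT}) : P \subset S -> (p.-group P)%g.
Proof. by move=> sPS; apply: pgroupS pS. Qed.

Section Sim.
Variables (P : {group gT}) (sPS : P \subset S).
Implicit Types a b c : gT -> gT.

(** Reciprocity divided by the nonzero factor m(b, c). *)
Lemma sim_mark b c : {in P, forall u, c u \in S} -> sim P b c ->
  forall a, mark P a c X = mark P a b X.
Proof.
rewrite simE => cS bc a; apply: (zloc_mulfI bc).
by rewrite mulrC X_frob // mulrC.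
Qed.

(** The congruence for the opposite of X gives some r with m(a, r) nonzero, and
reciprocity for a, a, r yields m(a, r) = m(a, a). *)
Lemma sim_refl a : hom_on P a -> sim P a a.
Proof.
case=> aS aM; have [m sm dm] := mark_homs_sum_op p_pr (sub_pgroup sPS) X_bifree aS aM.
have m0 : m != 0 by apply/pdvd_neq0/(pdvd_congr dm).
have /sum_neq0[r rP ar] : \sum_(r in homs P S) mark P a r X != 0.
  by rewrite sm zloc_mulf_eq0 negb_or cardG_zloc_neq0.
have [rS _] := homs_hom_on rP; rewrite simE.
have := X_frob a a rS => /eqP; rewrite -subr_eq0 -mulrBl zloc_mulf_eq0 (negPf ar) orbF.
by rewrite subr_eq0 => /eqP <-.
Qed.

Lemma sim_sym b c : {in P, forall u, b u \in S} -> hom_on P c -> sim P b c -> sim P c b.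
Proof.
move=> bS cH bc; have [cS _] := cH.
by rewrite simE -(sim_mark cS bc) -simE; apply: sim_refl.
Qed.

Lemma sim_trans a b c : {in P, forall u, c u \in S} -> sim P a b -> sim P b c -> sim P a c.
Proof. by move=> cS ab bc; rewrite simE (sim_mark cS bc) -simE. Qed.
End Sim.

Lemma sim_inj (P : {group gT}) a : {in P &, {morph a : u v / (u * v)%g}} ->
  sim P a id -> {in P &, injective a}.
Proof.
rewrite simE => aM aid u v Pu Pv e; apply/eqP; rewrite eq_mulgV1; apply/eqP.
apply: contrapT => uv; case/eqP: aid.
have Puv : (u * v^-1)%g \in P by rewrite groupM ?groupV.
apply: (bifree_mark X_bifree Puv) uv.
by apply: (mulIg (a v)); rewrite -aM // mulgKV mul1g.
Qed.

(** The marks m(f, id) are divisible by |C_S(f(P))|; this is the case where the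
quotient is prime to p. It plays the role of f(P) being fully centralized. *)
Definition unit_mark (P : {group gT}) (f : gT -> gT) : Prop :=
  exists2 k, mark P f id X = #|'C_S(f @: P)%g|%:R * k & ~ zloc_pdvd k.

Lemma hom_onJ (P : {group gT}) (f : gT -> gT) : hom_on P f ->
  {in P &, forall u t, f (u ^ t)%g = (f u ^ f t)%g}.
Proof.
move=> [fS fM] u t Pu Pt; rewrite !conjgE !fM ?groupM ?groupV //; congr (_ * _)%g.
apply: (mulIg (f t)); rewrite -fM ?groupV // !mulVg.
by apply: (mulIg (f 1%g)); rewrite -fM ?mulg1 ?mul1g ?group1.
Qed.

Lemma hom_stable (P : {group gT}) f : hom_on P f ->
  {in P, forall t, exists2 h, h \in S & {in P, forall u, f (u ^ t)%g = (f u ^ h)%g}}.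
Proof.
move=> fH t Pt; exists (f t); first exact: fH.1.
by move=> u Pu; apply: (hom_onJ fH).
Qed.

(** By the extension congruence the marks of the extensions of f to T do not
all vanish. *)
Lemma extend_unit_mark (Q T : {group gT}) (f : gT -> gT) :
    (Q <| T)%g -> T \subset S ->
    {in T, forall t, exists2 h, h \in S & {in Q, forall u, f (u ^ t)%g = (f u ^ h)%g}} ->
    unit_mark Q f ->
  exists r : {ffun gT -> gT}, [/\ r \in homs T S, {in Q, r =1 f} & sim T r id].
Proof.
move=> nQT sTS fst [k fk nk]; have [idS idM] := hom_on_id sTS.
have [k' [m [fk' sm km]]] := mark_extension p_pr X (sub_pgroup sTS) nQT idS idM fst.
have kk : k' = k by apply: (zloc_mulfI (cent_zloc_neq0 (f @: Q))); rewrite -fk -fk'.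
have m0 : m != 0 by apply/pdvd_neq0/(pdvd_congr km); rewrite kk.
have /sum_neq0[r /andP[rT /forall_inP rf] rid] :
    \sum_(r in homs T S | [forall u in Q, r u == f u]) mark T r id X != 0.
  by rewrite sm zloc_mulf_eq0 negb_or cardG_zloc_neq0.
by exists r; rewrite simE; split=> // u /rf/eqP.
Qed.

(** The weights m(r, id) are invariant under D, since D consists of morphisms:
m(r d^-1, id) = m(r d^-1, d^-1), and this is m(r, id) after reindexing by d. *)
Lemma exists_unit_mark (P : {group gT}) (D : {group {perm gT}}) :
    P \subset S -> D \subset Aut P -> (p.-group D)%g ->
    {in D, forall d : {perm gT}, sim P d id} ->
  exists r : {ffun gT -> gT}, [/\ r \in homs P S, sim P r id, unit_mark P r &
    {in D, forall d : {perm gT}, exists2 s, s \in S &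
       {in P, forall u, r (d u) = (r u ^ s)%g}}].
Proof.
move=> sPS sDP pD simD; have [idS idM] := hom_on_id sPS.
have [e se de] := mark_homs_sum p_pr X (sub_pgroup sPS) idS idM.
have ne : ~ zloc_pdvd e by move/(pdvd_congr de).
have /choice[k wk] : forall r : {ffun gT -> gT}, exists k, r \in homs P S ->
    mark P r id X = #|'C_S(r @: P)%g|%:R * k.
  move=> r; have [rP|rP] := boolP (r \in homs P S); last by exists 0.
  have [k [_ [-> _ _]]] := mark_extension p_pr X (sub_pgroup sPS) (normal_refl P)
    idS idM (hom_stable (homs_hom_on rP)).
  by exists k.
have [|r rP [nk rD]] := exists_unit_orbit pD sDP wk _ se ne.
  move=> r [s d] rP /setXP[/= sS dD].
  have dVD : (d^-1)%g \in D by rewrite groupV.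
  have dP : (d^-1)%g @: P = P.
    by apply: im_perm_on; have /(subsetP sDP)/setIdP[] := dVD.
  rewrite (@eq_mark _ _ _ _ _ _ _ _ (fun u => (r ((d^-1)%g u) ^ s)%g) _ id); last 2 first.
  - by move=> u _; rewrite ffunE.
  - by [].
  rewrite mark_conjl // (sim_mark idS (simD _ dVD)).
  by rewrite -(mark_imset P (d^-1)%g r id X) dP.
exists r; split=> //; last by exists (k r); rewrite // wk.
by rewrite simE wk // zloc_mulf_eq0 negb_or cardG_zloc_neq0 pdvd_neq0.
Qed.

(** The marks m(r, f) of the r : P -> S add up to |S| times a unit. Grouping the
r by their restrictions g to Q, exists_unit_orbit yields a g for which the
part of the sum over its extensions is a unit relative to C_S(g(Q)). Since f is
related to id on P, this part does not change if f is replaced by id. The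
extension congruence then shows that both m(g, f) and m(g, id) are nonzero on
Q, so that f and id are related on Q. *)
Lemma restrict_sim_normal (Q P : {group gT}) (f : gT -> gT) :
  (Q <| P)%g -> P \subset S -> hom_on P f -> sim P f id -> sim Q f id.
Proof.
move=> nQP sPS fH fid; have [idS idM] := hom_on_id sPS; have [fS fM] := fH.
have sQP := normal_sub nQP; have sQS := subset_trans sQP sPS.
have [e se de] := mark_homs_sum p_pr X (sub_pgroup sPS) fS fM.
have ne : ~ zloc_pdvd e by move/(pdvd_congr de).
pose ext (r g : {ffun gT -> gT}) := hrestr Q r == g.
have extE (r g : {ffun gT -> gT}) : g \in homs Q S -> r \in homs P S ->
    ext r g = [forall u in Q, r u == g u].
  move=> gQ rP; apply/eqP/forall_inP=> [<- u Qu|rg]; first by rewrite hrestrE.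
  apply: (homs_inj _ gQ) => [|u Qu]; last by rewrite hrestrE // (eqP (rg u Qu)).
  by have [rS rM] := hom_on_sub sQP (homs_hom_on rP); apply: hrestr_homs.
pose w g := \sum_(r in homs P S | ext r g) mark P r f X.
have wE g : g \in homs Q S -> w g = \sum_(r in homs P S | [forall u in Q, r u == g u]) mark P r f X.
  by move=> gQ; apply: eq_bigl => r; case: (boolP (r \in _)) => //= rP; rewrite extE.
have stab (g r : {ffun gT -> gT}) : g \in homs Q S -> r \in homs P S -> ext r g ->
    {in P, forall t, exists2 h, h \in S & {in Q, forall u, g (u ^ t)%g = (g u ^ h)%g}}.
  move=> gQ rP; rewrite extE // => /forall_inP rg t Pt.
  have [h hS rh] := hom_stable (homs_hom_on rP) Pt; exists h => // u Qu.
  have Qut : (u ^ t)%g \in Q by rewrite memJ_norm // (subsetP (normal_norm nQP)).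
  by rewrite -(eqP (rg _ Qu)) -(eqP (rg _ Qut)) rh // (subsetP sQP).
have /choice[k wk] : forall g : {ffun gT -> gT}, exists k, g \in homs Q S ->
    w g = #|'C_S(g @: Q)%g|%:R * k.
  move=> g; have [gQ|gQ] := boolP (g \in homs Q S); last by exists 0.
  have [/existsP[r /andP[rP rg]]|none] := boolP [exists r, (r \in homs P S) && ext r g].
    have [_ [m [_ sm _]]] := mark_extension p_pr X (sub_pgroup sPS) nQP fS fM (stab g r gQ rP rg).
    by exists m => _; rewrite wE.
  exists 0 => _; rewrite mulr0 /w big_pred0 // => r; apply: contraNF none => rg.
  by apply/existsP; exists r.
have sw : \sum_(g in homs Q S) w g = #|S|%:R * e.
  rewrite -se; apply/esym; apply: partition_big => r rP.
  by have [rS rM] := hom_on_sub sQP (homs_hom_on rP); apply: hrestr_homs.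
pose D1 : {group {perm gT}} := 1%G.
have [|g gQ [nk _]] := exists_unit_orbit (pgroup1 _ p : p.-group D1)%g (sub1G _) wk _ sw ne.
  move=> g [s d] gQ /setXP[/= sS /set1P->] /=.
  have sE : (s, 1%g) \in setX_group S D1 by rewrite in_setX sS group1.
  have hs r : hrestr Q (hom_action gT r (s, 1%g)) = hom_action gT (hrestr Q r) (s, 1%g).
    apply/ffunP=> u; rewrite !ffunE /= invg1 perm1.
    by case: ifP; rewrite ?conj1g.
  rewrite /w (reindex_inj (act_inj (hom_action gT) (s, 1%g))) /=.
  apply: eq_big => [r|r _]; last first.
    rewrite -[RHS](mark_conjl P r f X sS); apply: eq_mark => // u _.
    by rewrite ffunE /= invg1 perm1.
  rewrite -[hact r _]/(hom_action gT r (s, 1%g)) (actsP (acts_homs S (sub1G _ : D1 \subset Aut P)) _ sE).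
  by rewrite /ext hs (inj_eq (act_inj _ _)).
have w0 : w g != 0 by rewrite wk // zloc_mulf_eq0 negb_or cardG_zloc_neq0 pdvd_neq0.
have [r /andP[rP rg] _] := sum_neq0 w0; have gst := stab g r gQ rP rg.
have [k1 [m1 [gk1 sm1 km1]]] := mark_extension p_pr X (sub_pgroup sPS) nQP fS fM gst.
have [k2 [m2 [gk2 sm2 km2]]] := mark_extension p_pr X (sub_pgroup sPS) nQP idS idM gst.
have m1k : m1 = k g by apply: (zloc_mulfI (cent_zloc_neq0 (g @: Q))); rewrite -wk // -sm1 wE.
have m21 : m2 = m1.
  apply: (zloc_mulfI (cent_zloc_neq0 (g @: Q))); rewrite -sm1 -sm2.
  by apply: eq_bigr => r' _; apply: sim_mark.
have nk1 : k1 != 0 by apply/pdvd_neq0/(pdvd_congr km1); rewrite m1k.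
have nk2 : k2 != 0 by apply/pdvd_neq0/(pdvd_congr km2); rewrite m21 m1k.
have gf : sim Q g f by rewrite simE gk1 zloc_mulf_eq0 negb_or cardG_zloc_neq0.
have gid : sim Q g id by rewrite simE gk2 zloc_mulf_eq0 negb_or cardG_zloc_neq0.
have [gS _] := homs_hom_on gQ; have fQ := hom_on_sub sQP fH.
by apply: sim_trans gid; [exact: (hom_on_id sQS).1|apply: sim_sym].
Qed.

(** Proper subgroups of a p-group grow in their normalizers. *)
Lemma restrict_sim (Q P : {group gT}) (f : gT -> gT) :
  Q \subset P -> P \subset S -> hom_on P f -> sim P f id -> sim Q f id.
Proof.
have [n] := ubnP (#|P| - #|Q|); elim: n => // n IHn in P Q *; rewrite ltnS => leQn sQP sPS fH fid.
have [->|nQP] := eqVneq Q P; first by [].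
have ltQP : Q \proper P by rewrite properEneq sQP andbT; apply: contraNneq nQP => /val_inj->.
have ltQN : Q \proper 'N_P(Q)%g.
  by apply: nilpotent_proper_norm ltQP; apply: pgroup_nil (sub_pgroup sPS).
have sNP : 'N_P(Q)%g \subset P by apply: subsetIl.
apply: (@restrict_sim_normal Q 'N_P(Q)%G); rewrite ?normalSG //.
- exact: subset_trans sPS.
- exact: hom_on_sub fH.
have lt : (#|P| - #|'N_P(Q)%g| < n)%N.
  by apply: leq_trans leQn; rewrite ltn_sub2l ?proper_card.
exact: (IHn _ _ lt sNP sPS fH fid).
Qed.


(** * The fusion system of a reciprocal element *)
Definition mark_hom (P Q : {group gT}) (f : {morphism P >-> gT}) : Prop :=
  [/\ P \subset S, Q \subset S, (f @* P)%g \subset Q & sim P f id].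

Lemma morph_hom_on (P Q : {group gT}) (f : {morphism P >-> gT}) :
  Q \subset S -> (f @* P)%g \subset Q -> hom_on P f.
Proof.
move=> sQS sfQ; split=> [u Pu|u v Pu Pv]; last exact: morphM.
by apply/(subsetP sQS)/(subsetP sfQ)/mem_morphim.
Qed.

Lemma sim_morphim (P : {group gT}) (f : {morphism P >-> gT}) (g : gT -> gT) :
  sim (f @* P)%g g id = sim P (g \o f) f.
Proof. by rewrite !simE morphimEdom mark_imset. Qed.

Lemma eq_sim (P : {set gT}) (a a' b b' : gT -> gT) :
  {in P, a =1 a'} -> {in P, b =1 b'} -> sim P a b = sim P a' b'.
Proof. by move=> ea eb; rewrite !simE (eq_mark X ea eb). Qed.

Fact mark_hom_obj (P Q : {group gT}) (f : {morphism P >-> gT}) :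
  mark_hom Q f -> [/\ P \subset S, Q \subset S, (f @* P)%g \subset Q & 'injm f]%g.
Proof.
case=> sPS sQS sfQ fid; split=> //; apply/injmP.
have [_ fM] := morph_hom_on sQS sfQ.
exact: sim_inj fM fid.
Qed.

Fact mark_hom_comp (P Q R : {group gT}) (f : {morphism P >-> gT})
    (g : {morphism Q >-> gT}) (k : {morphism P >-> gT}) :
  mark_hom Q f -> mark_hom R g -> {in P, forall u, k u = g (f u)} -> mark_hom R k.
Proof.
move=> [sPS sQS sfQ fid] [_ sRS sgR gid] kgf.
have kR : {in P, forall u, k u \in R}.
  move=> u Pu; rewrite kgf //; apply: (subsetP sgR).
  by apply: mem_morphim; apply: (subsetP sfQ); apply: mem_morphim.
split=> //; first by apply/subsetP=> _ /morphimP[u _ Pu ->]; apply: kR.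
have := restrict_sim sfQ sQS (morph_hom_on sRS sgR) gid.
rewrite sim_morphim => gff; rewrite (@eq_sim _ _ (g \o f) _ id) //.
exact: sim_trans (hom_on_id sPS).1 gff fid.
Qed.

Fact mark_hom_conj (P Q : {group gT}) (f : {morphism P >-> gT}) (x : gT) :
  P \subset S -> Q \subset S -> x \in S ->
  {in P, forall u, f u = (x * u * x^-1)%g} -> (f @* P)%g \subset Q -> mark_hom Q f.
Proof.
move=> sPS sQS xS fx sfQ; split=> //.
rewrite (@eq_sim _ _ (fun u => u ^ x^-1)%g _ id) // => [|u Pu]; last first.
  by rewrite fx // conjgE invgK mulgA.
rewrite simE (mark_conjl P id id X); last by rewrite groupV.
by rewrite -simE; exact: sim_refl (hom_on_id sPS).
Qed.

Fact mark_hom_onto (P Q : {group gT}) (f : {morphism P >-> gT}) :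
  mark_hom Q f -> mark_hom (f @* P)%G f.
Proof. by move=> [sPS sQS sfQ fid]; split=> //; apply: subset_trans sQS. Qed.

Fact mark_hom_inv (P Q : {group gT}) (f : {morphism P >-> gT})
    (g : {morphism (f @* P)%g >-> gT}) :
  mark_hom Q f -> {in P, forall u, g (f u) = u} -> mark_hom P g.
Proof.
move=> [sPS sQS sfQ fid] gf; split=> //; first exact: subset_trans sQS.
  apply/subsetP=> _ /morphimP[_ _ /morphimP[u _ Pu ->] ->] /=.
  by rewrite gf.
rewrite sim_morphim (@eq_sim _ _ id _ f) //.
exact: sim_sym (morph_hom_on sQS sfQ).1 (hom_on_id sPS) fid.
Qed.

Definition mark_fusion : fusion_system S :=
  FusionSystem mark_hom_obj mark_hom_comp mark_hom_conj mark_hom_onto mark_hom_inv.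

(** Generation is span_of_marks applied to the family of morphisms: the marks of
X vanish outside of it by definition. Stability is sim_mark. *)
Lemma mark_fusion_right_characteristic : right_characteristic mark_fusion X.
Proof.
split=> //.
- pose B (K : {group gT}) (f : {morphism K >-> gT}) := fhom mark_fusion S f.
  have [K L f g sKS sfS _ _ Bg fg|K f sKS sfS nB|s Bs ->] := @span_of_marks p gT gT S S B X.
  + exact: fhom_subconj Bg fg.
  + apply/eqP/negPn; rewrite -simE; apply/negP=> fid; case: nB; split=> //.
  exists s => // cb /Bs[K [f [BKf ->]]]; exists K, f; split=> //.
- move=> P f [sPS _ sfS fid]; apply: mark_inj => K g sKP sgS.
  have KP : {in K, forall u, id u \in P} by move=> u /(subsetP sKP).
  have siS : (idm_morphism P @* P)%g \subset S by rewrite /= morphim_idm.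
  rewrite (mark_bcomp_trans g X sfS KP) (mark_bcomp_trans g X siS KP).
  have sKS := subset_trans sKP sPS; have fH := morph_hom_on (subxx S) sfS.
  have fK := restrict_sim sKP sPS fH fid.
  exact: esym (sim_mark (hom_on_id sKS).1 fK g).
Qed.

Local Notation F := mark_fusion.

Lemma sim_fAut (P : {group gT}) (d : {perm gT}) : d \in fAut F P -> sim P d id.
Proof.
case/setIdP=> _ /asboolP[f [_ _ _ fid] fd].
by rewrite -(@eq_sim P f d id id).
Qed.

Lemma fAutS_p (P : {group gT}) : (p.-group (fAutS S P))%g.
Proof. by apply: morphim_pgroup; apply: pgroupS pS; apply: subsetIl. Qed.

Lemma fAutS_sub (P : {group gT}) : P \subset S -> fAutS S P \subset fAut F P.
Proof.
move=> sPS; apply/subsetP=> _ /morphimP[x Nx /setIP[Sx _] ->].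
have Aa : conj_aut P x \in Aut P by rewrite Aut_aut.
rewrite inE Aa; apply/asboolP; exists (autm_morphism Aa) => //.
apply: (@fhom_conj _ _ F _ _ _ x^-1) => //; first by rewrite groupV.
  by move=> u Pu; rewrite /= autmE norm_conj_autE // conjgE invgK mulgA.
by rewrite im_autm.
Qed.

(** Any unit pair (P, r) for which D becomes induced by S tolerates N_S(P),
because D contains Aut_S(P). *)
Lemma exists_normalizer_embedding (P : {group gT}) (D : {group {perm gT}}) :
    P \subset S -> fAutS S P \subset D -> D \subset fAut F P -> (p.-group D)%g ->
  exists r : {ffun gT -> gT}, [/\ r \in homs 'N_S(P)%G S, sim 'N_S(P)%g r id,
    unit_mark P r &
    {in D, forall d : {perm gT}, exists2 s, s \in S &
       {in P, forall u, r (d u) = (r u ^ s)%g}}].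
Proof.
move=> sPS sSD sDF pD.
have sDA : D \subset Aut P by apply: subset_trans sDF _; apply/subsetP=> d /setIdP[].
have simD : {in D, forall d : {perm gT}, sim P d id}.
  by move=> d /(subsetP sDF)/sim_fAut.
have [r [rP rid [k rk nk] rD]] := exists_unit_mark sPS sDA pD simD.
have sNS : 'N_S(P)%g \subset S by apply: subsetIl.
have rst : {in 'N_S(P)%G, forall t, exists2 h, h \in S &
             {in P, forall u, r (u ^ t)%g = (r u ^ h)%g}}.
  move=> t NSt; have [St Nt] := setIP NSt.
  have dD : conj_aut P t \in D by apply: (subsetP sSD); apply: mem_morphim.
  have [s sS rs] := rD _ dD; exists s => // u Pu.
  by rewrite -rs // norm_conj_autE.
have [r' [r'N rr' r'id]] := extend_unit_mark (normalSG sPS) sNS rst (ex_intro2 _ _ k rk nk).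
have eim : r' @: P = r @: P by apply: eq_in_imset => u /rr'.
have DP d u : d \in D -> u \in P -> d u \in P.
  by move=> /(subsetP sDA)/setIdP[/perm_closed-> _].
exists r'; split=> //.
  by exists k; rewrite // eim -rk; apply: eq_mark.
move=> d dD; have [s sS rs] := rD d dD; exists s => // u Pu.
by rewrite !rr' ?DP ?rs.
Qed.

Lemma homs_morph (P : {group gT}) (r : {ffun gT -> gT}) : r \in homs P S ->
  {in P &, {morph r : u v / (u * v)%g}}.
Proof. by case/homs_hom_on. Qed.

Lemma hom_on_cent (P : {group gT}) (f : gT -> gT) (Q : {set gT}) : hom_on P f ->
  Q \subset P -> {in P, forall z, z \in 'C(Q)%g -> f z \in 'C_S(f @: Q)%g}.
Proof.
move=> fH sQP z Pz cz; rewrite inE fH.1 //; apply/centP=> _ /imsetP[u Qu ->].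
have Pu := subsetP sQP u Qu.
by rewrite /commute -!fH.2 // (centP cz).
Qed.

(** A unit pair (Q, f) extends to Q C_S(Q), and the extension embeds C_S(Q) into
C_S(f(Q)). *)
Lemma card_cent_unit_mark (Q : {group gT}) (f : gT -> gT) :
  Q \subset S -> hom_on Q f -> unit_mark Q f -> (#|'C_S(Q)%g| <= #|'C_S(f @: Q)%g|)%N.
Proof.
move=> sQS fH uf; pose T := (Q <*> 'C_S(Q))%G.
have cC : 'C_S(Q)%g \subset 'C(Q)%g by apply: subsetIr.
have sTS : T \subset S by rewrite join_subG sQS subsetIl.
have nQT : (Q <| T)%g by rewrite normalYl; apply: cents_norm.
have fst : {in T, forall t, exists2 h, h \in S & {in Q, forall u, f (u ^ t)%g = (f u ^ h)%g}}.
  move=> t; rewrite /= cent_joinEr // => /mulsgP[q c Qq Cc ->].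
  exists (f q); first exact: fH.1.
  move=> u Qu; rewrite -(hom_onJ fH) // conjgM.
  congr f; apply/conjg_fixP/commgP/commute_sym/(centP (subsetP cC _ Cc)).
  by rewrite groupJ.
have [r [rT rf rid]] := extend_unit_mark nQT sTS fst uf.
have sCT : 'C_S(Q)%g \subset T by apply: joing_subr.
have injr := sim_inj (homs_morph rT) rid.
rewrite -(card_in_imset (f := r)); last first.
  by move=> u v /(subsetP sCT) Tu /(subsetP sCT) Tv; apply: injr.
apply/subset_leq_card/subsetP=> _ /imsetP[z Cz ->].
have -> : f @: Q = r @: Q by apply: eq_in_imset => u /rf.
apply: (hom_on_cent (homs_hom_on rT)); rewrite ?joing_subl ?(subsetP sCT) //.
exact: (subsetP cC).
Qed.

(** m(g f, id) = m(g f, f) by reciprocity, and this is a mark of g on f(P). *)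
Lemma unit_mark_comp (P : {group gT}) (f : {morphism P >-> gT}) (g : gT -> gT) :
  {in P, forall u, u \in S} -> sim P f id -> unit_mark (f @* P)%G g -> unit_mark P (g \o f).
Proof.
move=> PS fid [k gk nk]; exists k => //.
rewrite (sim_mark PS fid) -(mark_imset P f g id X) (imset_comp g f).
by have := gk; rewrite /= morphimEdom.
Qed.

(** Let r embed N_S(P) as in exists_normalizer_embedding, D being a Sylow
subgroup of Aut_F(P). As P is fully normalized, r maps N_S(P) onto
N_S(r(P)); so the elements of S that realize D through r come from N_S(P).
For the centralizer of a conjugate Q of P, card_cent_unit_mark bounds its order
by that of C_S(r(P)), which is the image of C_S(P). *)
Lemma mark_fusion_normalized (P : {group gT}) : fully_normalized F P ->
  fully_centralized F P /\ (p.-Sylow(fAut F P) (fAutS S P))%g.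
Proof.
case=> sPS maxN; pose A := Group (fAut_group_set F sPS).
have [D sylD sSD] := Sylow_superset (fAutS_sub sPS : fAutS S P \subset A) (fAutS_p P).
have sDA : D \subset fAut F P by apply: pHall_sub sylD.
have [r [rN rid ur rD]] := exists_normalizer_embedding sPS sSD sDA (pHall_pgroup sylD).
have sNS : 'N_S(P)%g \subset S by apply: subsetIl.
have sPN : P \subset 'N_S(P)%g by rewrite subsetI sPS normG.
have rH := homs_hom_on rN; have injr := sim_inj (homs_morph rN) rid.
pose f : {morphism P >-> gT} := Morphism (hom_on_sub sPN rH).2.
have fP : (f @* P)%g = r @: P by rewrite morphimEdom.
have sfS : (f @* P)%g \subset S.
  by rewrite fP; apply/subsetP=> _ /imsetP[u /(subsetP sPN) Nu ->]; apply: rH.1.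
have Ff : fhom F S f.
  by split=> //; apply: restrict_sim rid.
have sub_im : r @: 'N_S(P)%g \subset 'N_S(r @: P)%g.
  apply/subsetP=> _ /imsetP[t Nt ->]; rewrite inE rH.1 //=; apply/normP/eqP.
  rewrite eqEcard cardJg leqnn andbT; apply/subsetP=> _ /imsetP[_ /imsetP[u Pu ->] ->].
  have Nu := subsetP sPN u Pu; rewrite -(hom_onJ rH) //; apply: imset_f.
  by rewrite memJ_norm //; case/setIP: Nt.
have imN : r @: 'N_S(P)%g = 'N_S(r @: P)%g.
  apply/eqP; rewrite eqEcard sub_im card_in_imset // -fP.
  exact: (maxN (f @* P)%G (fconj_im Ff)).
have lift s : s \in 'N_S(r @: P)%g -> exists2 x, x \in 'N_S(P)%g & s = r x.
  by rewrite -imN => /imsetP.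
(* The element s realizing d through r normalizes r(P), so s = r(x) for some
   x in N_S(P), and d is conjugation by x. *)
have DS : D \subset fAutS S P.
  apply/subsetP=> d dD; have [s sS rs] := rD d dD.
  have DP u : u \in P -> d u \in P.
    by have /(subsetP sDA)/setIdP[/setIdP[/perm_closed e _] _] := dD; rewrite e.
  have Ns : s \in 'N_S(r @: P)%g.
    rewrite inE sS /=; apply/normP/eqP; rewrite eqEcard cardJg leqnn andbT.
    by apply/subsetP=> _ /imsetP[_ /imsetP[u Pu ->] ->]; rewrite -rs // imset_f ?DP.
  have [x Nx sx] := lift s Ns; have [_ nPx] := setIP Nx.
  suff -> : d = conj_aut P x by apply: mem_morphim.
  have dA : d \in Aut P by have /(subsetP sDA)/setIdP[] := dD.
  apply: (eq_Aut dA) => [|u Pu]; first by rewrite Aut_aut.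
  rewrite norm_conj_autE //; apply: injr; rewrite ?(subsetP sPN) ?DP ?memJ_norm //.
  by rewrite rs // sx (hom_onJ rH) // (subsetP sPN).
have SD : fAutS S P = D by apply/eqP; rewrite eqEsubset sSD DS.
split; last by rewrite SD.
split=> // Q [g1 [g2 [Fg1 Fg2 g12 g21]]].
have [sQS _ sg2 g2id] := Fg2.
have g2Q : (g2 @* Q)%G = P.
  apply/group_inj/eqP; rewrite eqEsubset sg2; apply/subsetP=> u Pu.
  have Qu : g1 u \in Q by have [_ _ /subsetP + _] := Fg1; apply; apply: mem_morphim.
  by rewrite -(g12 u Pu); apply: mem_morphim.
have ug : unit_mark Q (r \o g2) by apply: (@unit_mark_comp Q g2 r (hom_on_id sQS).1 g2id); rewrite g2Q.
have hg : hom_on Q (r \o g2).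
  have g2N u : u \in Q -> g2 u \in 'N_S(P)%g.
    by move=> Qu; apply/(subsetP sPN)/(subsetP sg2)/mem_morphim.
  split=> [u Qu|u v Qu Qv] /=; first by rewrite rH.1 ?g2N.
  by rewrite morphM // rH.2 ?g2N.
apply: leq_trans (card_cent_unit_mark sQS hg ug) _.
rewrite imset_comp -morphimEdom -[(g2 @* Q)%g]/(gval (g2 @* Q)%G) g2Q.
rewrite -[leqRHS](card_in_imset (f := r)); last first.
  by move=> u v /(subsetP (setIS S (cent_sub P))) Nu /(subsetP (setIS S (cent_sub P))) Nv; apply: injr.
apply/subset_leq_card/subsetP=> s Cs.
have [x Nx sx] := lift s (subsetP (setIS S (cent_sub _)) s Cs).
rewrite sx; apply: imset_f; case/setIP: Nx (Nx) => Sx nPx Nx.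
rewrite inE Sx; apply/centP=> u Pu; apply/commute_sym/commgP/conjg_fixP.
have Nu := subsetP sPN u Pu.
apply: injr; rewrite ?(subsetP sPN) ?memJ_norm //.
rewrite (hom_onJ rH) // -sx; apply/conjg_fixP/commgP/commute_sym.
by case/setIP: Cs => _ /centP; apply; apply: imset_f.
Qed.

(** Let Q = f(P) and r an embedding of N_S(Q) as in exists_normalizer_embedding.
Then r f has a unit mark, so it extends to a homomorphism b on N_f. For t in
N_f, some y in N_S(Q) acts on Q as t does on P; so b(t) and r(y) differ by an
element of C_S(r(Q)), which is r(C_S(Q)) because Q is fully centralized. Hence
b takes its values in the image of r, and r^-1 b is the extension sought. *)
Lemma mark_fusion_extension (P : {group gT}) (f : {morphism P >-> gT}) :
    fhom F S f -> fully_centralized F (f @* P)%G ->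
  exists2 g : {morphism (extender S f) >-> gT}, fhom F S g & {in P, g =1 f}.
Proof.
move=> Ff [sQS maxC]; have [sPS _ sfS fid] := Ff; set Q := (f @* P)%G in sQS maxC.
have [r [rN rid ur _]] := exists_normalizer_embedding sQS (subxx _) (fAutS_sub sQS) (fAutS_p Q).
have sNS : 'N_S(Q)%g \subset S by apply: subsetIl.
have sQN : Q \subset 'N_S(Q)%g by rewrite subsetI sQS normG.
have sCN : 'C_S(Q)%g \subset 'N_S(Q)%g by rewrite setIS ?cent_sub.
have rH := homs_hom_on rN; have injr := sim_inj (homs_morph rN) rid.
have fQ u : u \in P -> f u \in Q by move=> Pu; apply: mem_morphim.
have fN u : u \in P -> f u \in 'N_S(Q)%g by move=> /fQ/(subsetP sQN).
(* As Q is fully centralized, C_S(r(Q)) is not larger than C_S(Q). *)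
have imC : r @: 'C_S(Q)%g = 'C_S(r @: Q)%g.
  apply/eqP; rewrite eqEcard; apply/andP; split.
    apply/subsetP=> _ /imsetP[z Cz ->]; apply: (hom_on_cent rH) => //.
      exact: (subsetP sCN).
    by case/setIP: Cz.
  rewrite card_in_imset => [|u v Cu Cv]; last by apply: injr; apply: (subsetP sCN).
  pose rQ : {morphism Q >-> gT} := Morphism (hom_on_sub sQN rH).2.
  have rQE : (rQ @* Q)%g = r @: Q by rewrite morphimEdom.
  have sr : (rQ @* Q)%g \subset S.
    by rewrite rQE; apply/subsetP=> _ /imsetP[u /(subsetP sQN) Nu ->]; apply: rH.1.
  have FrQ : fhom F S rQ by split=> //; apply: restrict_sim rid.
  by rewrite -rQE; apply: (maxC (rQ @* Q)%G (fconj_im FrQ)).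
pose T := extender S f.
have sTN : T \subset 'N_S(P)%g by apply/subsetP=> t /setIdP[].
have sTS : T \subset S by apply: subset_trans sTN (subsetIl _ _).
have sPT : P \subset T.
  apply/subsetP=> u Pu; rewrite inE; apply/andP; split.
    by rewrite inE (subsetP sPS) //= (subsetP (normG P)).
  apply/exists_inP; exists (f u); first exact: fN.
  by apply/forall_inP=> v Pv; rewrite !morphM ?groupM ?groupV ?morphV.
have nPT : (P <| T)%g.
  by rewrite /normal sPT; apply: subset_trans sTN (subsetIr _ _).
have Tconj t : t \in T -> exists2 y, y \in 'N_S(Q)%g & {in P, forall u, f (u ^ t)%g = (f u ^ y)%g}.
  rewrite -groupV => /setIdP[_ /exists_inP[y Ny /forall_inP fy]].
  exists y^-1%g; first by rewrite groupV.
  by move=> u Pu; have /eqP := fy u Pu; rewrite invgK conjgE mulgA => ->; rewrite conjgE invgK mulgA.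
have rfst : {in T, forall t, exists2 h, h \in S & {in P, forall u, (r \o f) (u ^ t)%g = ((r \o f) u ^ h)%g}}.
  move=> t /Tconj[y Ny fy]; exists (r y); first exact: rH.1.
  by move=> u Pu /=; rewrite fy // (hom_onJ rH) // fN.
have urf : unit_mark P (r \o f) by apply: (@unit_mark_comp P f r (hom_on_id sPS).1 fid).
have [b [bT brf bid]] := extend_unit_mark nPT sTS rfst urf.
have bH := homs_hom_on bT.
have b_im t : t \in T -> exists2 x, x \in 'N_S(Q)%g & b t = r x.
  move=> Tt; have [y Ny fy] := Tconj t Tt.
  have Cc : (b t * (r y)^-1)%g \in 'C_S(r @: Q)%g.
    rewrite inE groupM ?groupV ?rH.1 ?bH.1 //=.
    apply/centP=> _ /imsetP[_ /morphimP[u _ Pu ->] ->].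
    apply/commute_sym/commgP/conjg_fixP.
    have rfb : r (f u) = b u by rewrite brf.
    have Put : (u ^ t)%g \in P by rewrite memJ_norm // (subsetP (normal_norm nPT)).
    rewrite conjgM rfb -(hom_onJ bH (subsetP sPT u Pu) Tt) (brf _ Put) /= fy //.
    by rewrite (hom_onJ rH) ?fN // rfb conjgK.
  move: Cc; rewrite -imC => /imsetP[z Cz ez]; exists (z * y)%g.
    by rewrite groupM // (subsetP sCN).
  by rewrite (rH.2 _ _ (subsetP sCN z Cz) Ny) -ez mulgKV.
have /fin_all_exists[g gP] : forall t, exists x, t \in T -> x \in 'N_S(Q)%g /\ b t = r x.
  move=> t; have [/b_im[x Nx bx]|nT] := boolP (t \in T); first by exists x.
  by exists 1%g.
have gN t : t \in T -> g t \in 'N_S(Q)%g by move=> /gP[].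
have rg t : t \in T -> r (g t) = b t by move=> /gP[_ ->].
have gM : {in T &, {morph g : t s / (t * s)%g}}.
  move=> t s Tt Ts; apply: injr; rewrite ?groupM ?gN ?groupM //.
  by rewrite rH.2 ?gN // !rg ?groupM // bH.2.
pose gm : {morphism T >-> gT} := Morphism gM.
have gH : hom_on T g by split=> // t /gN/setIP[].
exists gm => [|u Pu]; last first.
  have Tu := subsetP sPT u Pu.
  by apply: injr; rewrite ?gN ?fN // rg // brf.
have sgN : (gm @* T)%g \subset 'N_S(Q)%g.
  by apply/subsetP=> _ /morphimP[t _ Tt ->]; apply: gN.
split=> //; first exact: subset_trans sgN sNS.
have bg : sim T b g.
  have e : sim (gm @* T)%g r id.
    exact: (@restrict_sim (gm @* T)%G 'N_S(Q)%G r sgN sNS rH rid).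
  rewrite sim_morphim in e.
  have eb : {in T, r \o g =1 b} by move=> t Tt; apply: rg.
  have eg : {in T, g =1 g} by [].
  by rewrite -(eq_sim eb eg).
exact: sim_trans (hom_on_id sTS).1 (sim_sym sTS bH.1 gH bg) bid.
Qed.

Lemma mark_fusion_saturated : saturated p F.
Proof. by split; [exact: mark_fusion_normalized | exact: mark_fusion_extension]. Qed.
End FrobeniusTheory.

Theorem theorem2 (p : nat) (gT : finGroupType) (S : {group gT})
    (X : burnside p S S)
    (p_prime : prime p) (pS : (p.-group S)%g)
    (X_bifree : bifree_element X) (X_aug : ~ zloc_pdvd (baug X)) :
  (exists F : fusion_system S, saturated p F /\ right_characteristic F X)
  <-> frobenius_reciprocity X.
Proof.
split=> [[F [_ [gen stab _]]]|X_frob].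
  exact: right_characteristic_frobenius gen stab.
have X_mark (K : {set gT}) := frobenius_mark X_frob (K := K).
exists (mark_fusion p_prime pS X_bifree X_aug X_mark); split.
  exact: mark_fusion_saturated.
exact: mark_fusion_right_characteristic.
Qed.
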